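(* For every $n\ge 2$ there exist $\delta=\delta_n>0$ and a constant $K_n>0$ such that for every prime $p$, all $r_1,\dots,r_n\in\mathbb{N}_0$ with $C=(p^{r_1},\dots,p^{r_n})$, and all characters $\psi,\psi'$ attached to integers $\psi_1,\dots,\psi_n$ and $\psi_1',\dots,\psi_n'$, $$\big|\mathrm{Kl}_p(\psi,\psi',C^{\ast}w_l)\big|\le K_n\Big(\max_{1\le j\le n}|\psi_j|_p^{-1/2}\Big)\Big(\prod_{1\le k\le n}p^{r_k}\Big)^{1-\delta}.$$
   Context: $|\cdot|_p$ is the $p$-adic absolute value with $|p|_p=1/p$ (and $|0|_p^{-1/2}=+\infty$, so the bound is void if some $\psi_j=0$). Let $G=\mathrm{GL}(n+1)$, $T$ the diagonal torus, $U$ the group of upper triangular unipotent matrices, $U^\top$ the lower triangular unipotent matrices. For $u\in U$ and $1\le i\le j\le n$, $u_{ij}$ denotes the entry of $u$ in row $i$ and column $j+1$, so $u_{jj}$ is the $j$-th superdiagonal entry. $e$ denotes the standard additive character of $\mathbb{Q}_p/\mathbb{Z}_p$ (so $e(x)=\exp(2\pi i x)$ for $x\in\mathbb{Z}[1/p]$). For integers $\psi_j,\psi_j'$ put $\psi(u)=e(\sum_{j=1}^n\psi_ju_{jj})$ and $\psi'(u)=e(\sum_{j=1}^n\psi'_ju_{jj})$. Kloosterman sums: for a signed permutation matrix $w$ put $U_w=U\cap w^{-1}U^\top w$. For $N=tw$ with $t\in T(\mathbb{Q}_p)$ put $C(N)=U(\mathbb{Q}_p)NU(\mathbb{Q}_p)\cap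 G(\mathbb{Z}_p)$ and $X(N)=U(\mathbb{Z}_p)\backslash C(N)/U_w(\mathbb{Z}_p)$. Each $x\in C(N)$ is uniquely $x=u(x)Nu'(x)$ with $u(x)\in U(\mathbb{Q}_p)$, $u'(x)\in U_w(\mathbb{Q}_p)$; this induces maps $u:X(N)\to U(\mathbb{Z}_p)\backslash U(\mathbb{Q}_p)$ and $u':X(N)\to U_w(\mathbb{Q}_p)/U_w(\mathbb{Z}_p)$, and $$\mathrm{Kl}_p(\psi,\psi',N)=\sum_{x\in X(N)}\psi(u(x))\,\psi'(u'(x)).$$ $w_l$ is the $(n+1)\times(n+1)$ antidiagonal matrix whose entry in row $i$ and column $n+2-i$ is $(-1)^{n+1-i}$; here $U_{w_l}=U$. $C^{\ast}=\mathrm{diag}(p^{-r_1},p^{r_1-r_2},\dots,p^{r_{n-1}-r_n},p^{r_n})$. *)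

(* Defs.v *)
From HB Require Import structures.
From mathcomp Require Import all_boot all_order all_algebra.
From mathcomp Require Import all_classical all_reals all_analysis.
From mathcomp Require Import complex.

Set Implicit Arguments.
Unset Strict Implicit.
Unset Printing Implicit Defensive.

Import Order.TTheory GRing.Theory Num.Theory.
Local Open Scope classical_set_scope.
Local Open Scope ring_scope.

(* Z_p is the inverse limit of the rings Z/p^k: a p-adic integer is the
   sequence of its least nonnegative residues modulo p^k.  The compatibility
   condition also forces residue k < p^k.  The proof that p is prime is an
   argument of the type, as it is what makes this ring a domain. *)
Record padic_int (p : nat) (p_pr : prime p) := PadicInt {
  residue :> nat -> nat;
  residue_compat : forall k, (residue k.+1 %% p ^ k = residue k)%N
}.

HB.instance Definition _ (p : nat) (p_pr : prime p) :=
  gen_eqMixin (padic_int p_pr).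
HB.instance Definition _ (p : nat) (p_pr : prime p) :=
  gen_choiceMixin (padic_int p_pr).

Section PadicIntRing.
Variables (p : nat) (p_pr : prime p).
Local Notation Zp := (padic_int p_pr).
Implicit Types x y z : Zp.

Let p_gt1 : (1 < p)%N := prime_gt1 p_pr.

Lemma padic_int_ext x y : (forall k, x k = y k) -> x = y.
Proof.
case: x y => [f fP] [g gP] /= /funext efg; subst g.
by congr PadicInt; exact: Prop_irrelevance.
Qed.

Lemma residue_mod x k : (x k %% p ^ k)%N = x k.
Proof. by rewrite -(residue_compat x k) modn_mod. Qed.

Lemma residue_mod_le x k m : (k <= m)%N -> (x m %% p ^ k)%N = x k.
Proof.
move=> /subnK <-; elim: (m - k)%N => [|d IHd]; first exact: residue_mod.
by rewrite -IHd -(residue_compat x (d + k)) modn_dvdm // dvdn_exp2l // leq_addl.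
Qed.

Let modSE (a k : nat) : ((a %% p ^ k.+1) %% p ^ k = a %% p ^ k)%N.
Proof. by rewrite modn_dvdm // dvdn_exp2l. Qed.

Definition padic_int_of_nat (a : nat) : Zp :=
  @PadicInt p p_pr (fun k => a %% p ^ k)%N (modSE a).

Lemma padic_add_compat x y k :
  (((x k.+1 + y k.+1) %% p ^ k.+1) %% p ^ k = (x k + y k) %% p ^ k)%N.
Proof. by rewrite modSE -modnDm !residue_compat. Qed.

Lemma padic_mul_compat x y k :
  (((x k.+1 * y k.+1) %% p ^ k.+1) %% p ^ k = (x k * y k) %% p ^ k)%N.
Proof. by rewrite modSE -modnMm !residue_compat. Qed.

Lemma padic_opp_compat x k :
  (((p ^ k.+1 - x k.+1) %% p ^ k.+1) %% p ^ k = (p ^ k - x k) %% p ^ k)%N.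
Proof.
have p_gt0 m : (0 < p ^ m)%N by rewrite expn_gt0 ltnW.
have lex m : (x m <= p ^ m)%N by rewrite ltnW // -(residue_mod x m) ltn_mod.
rewrite modSE; apply/eqP; rewrite -(eqn_modDr (x k.+1)) subnK //.
rewrite -(modnDmr (p ^ k - x k)) residue_compat subnK // modnn.
by apply/eqP; rewrite expnS modnMl.
Qed.

Definition padic_add x y : Zp := PadicInt p_pr (padic_add_compat x y).
Definition padic_mul x y : Zp := PadicInt p_pr (padic_mul_compat x y).
Definition padic_opp x : Zp := PadicInt p_pr (padic_opp_compat x).

Lemma padic_addA : associative padic_add.
Proof.
by move=> x y z; apply: padic_int_ext => k /=; rewrite modnDmr modnDml addnA.
Qed.

Lemma padic_addC : commutative padic_add.
Proof. by move=> x y; apply: padic_int_ext => k /=; rewrite addnC. Qed.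

Lemma padic_add0 : left_id (padic_int_of_nat 0) padic_add.
Proof.
by move=> x; apply: padic_int_ext => k /=; rewrite mod0n add0n residue_mod.
Qed.

Lemma padic_addN : left_inverse (padic_int_of_nat 0) padic_opp padic_add.
Proof.
move=> x; apply: padic_int_ext => k /=; rewrite modnDml subnK ?modnn ?mod0n //.
by rewrite ltnW // -(residue_mod x k) ltn_mod expn_gt0 ltnW.
Qed.

HB.instance Definition _ := GRing.isZmodule.Build Zp
  padic_addA padic_addC padic_add0 padic_addN.

Lemma padic_mulA : associative padic_mul.
Proof.
by move=> x y z; apply: padic_int_ext => k /=; rewrite modnMmr modnMml mulnA.
Qed.

Lemma padic_mulC : commutative padic_mul.
Proof. by move=> x y; apply: padic_int_ext => k /=; rewrite mulnC. Qed.

Lemma padic_mul1 : left_id (padic_int_of_nat 1) padic_mul.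
Proof.
by move=> x; apply: padic_int_ext => k /=; rewrite modnMml mul1n residue_mod.
Qed.

Lemma padic_mulDl : left_distributive padic_mul padic_add.
Proof.
move=> x y z; apply: padic_int_ext => k /=.
by rewrite modnMml modnDm mulnDl.
Qed.

Lemma padic_oner_neq0 : padic_int_of_nat 1 != 0.
Proof.
apply/eqP => /(congr1 (fun x : Zp => x 1%N)) /=.
by rewrite expn1 mod0n modn_small.
Qed.

HB.instance Definition _ := GRing.Zmodule_isComNzRing.Build Zp
  padic_mulA padic_mulC padic_mul1 padic_mulDl padic_oner_neq0.

Definition padic_unit : pred Zp := fun x => `[< exists y, y * x = 1 >].

Definition padic_inv x : Zp := xget x [set y | y * x = 1].

Lemma padic_mulVx : {in padic_unit, left_inverse 1 padic_inv *%R}.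
Proof. by move=> x /asboolP /xgetPex; apply. Qed.

Lemma padic_unitP x y : y * x = 1 -> padic_unit x.
Proof. by move=> yx; apply/asboolP; exists y. Qed.

Lemma padic_inv_out : {in [predC padic_unit], padic_inv =1 id}.
Proof.
by move=> x /asboolPn nux; apply: xgetPN => y yx; apply: nux; exists y.
Qed.

HB.instance Definition _ := GRing.ComNzRing_hasMulInverse.Build Zp
  padic_mulVx padic_unitP padic_inv_out.

Lemma padic_int_idomain : GRing.integral_domain_axiom Zp.
Proof.
move=> x y xy0; case: eqVneq => //= x0; case: eqVneq => //= y0; exfalso.
have nz z : z != 0 -> exists2 k, z k != 0%N & ~~ (p ^ k %| z k)%N.
  move=> z0; have /existsNP[k zk] : ~ forall k, z k = 0%N.
    move=> h; case/eqP: z0; apply: padic_int_ext => k.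
    by rewrite h /= mod0n.
  by exists k; rewrite /dvdn ?residue_mod; apply/eqP.
have [i xi xiN] := nz _ x0; have [j yj yjN] := nz _ y0.
have /eqP := congr1 (fun z : Zp => z (i + j)%N) xy0.
rewrite /= mod0n -/(dvdn _ _) => dxy.
have dvd_low (z : Zp) k : (k <= i + j)%N ->
    (p ^ k %| z (i + j))%N = (p ^ k %| z k)%N.
  by move=> lek; rewrite /dvdn (residue_mod_le z lek) residue_mod.
have xnz : (0 < x (i + j))%N.
  by rewrite lt0n; apply: contra xiN => /eqP h; rewrite -dvd_low ?leq_addr // h.
have ynz : (0 < y (i + j))%N.
  by rewrite lt0n; apply: contra yjN => /eqP h; rewrite -dvd_low ?leq_addl // h.
move: dxy xiN yjN; rewrite -!dvd_low ?leq_addl ?leq_addr //.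
rewrite !pfactor_dvdn ?muln_gt0 ?xnz ?ynz // lognM // -!ltnNge => le1 lt1 lt2.
have lt3 : (logn p (x (i + j)) + logn p (y (i + j)) < i + j)%N.
  by rewrite -addSn leq_add // ltnW.
by rewrite ltnNge le1 in lt3.
Qed.

HB.instance Definition _ :=
  GRing.ComUnitRing_isIntegral.Build Zp padic_int_idomain.

End PadicIntRing.

Notation padic p_pr := {fraction (padic_int p_pr)}.

(* q is a fractional part of x: q lies in Z[1/p] and x - q lies in Z_p. *)
Definition is_frac_part (p : nat) (p_pr : prime p) (x : padic p_pr) (q : rat) :=
  (exists k : nat, q * p%:R ^+ k \is a Num.int) /\
  (exists z : padic_int p_pr, x = ratr q + tofrac z).

Definition frac_part (p : nat) (p_pr : prime p) (x : padic p_pr) : rat :=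
  xget 0 [set q | is_frac_part x q].

Definition expi (R : realType) (t : R) : R[i] := (cos t +i* sin t)%C.

(* A fractional part is unique up to Z, so this is the character of Q_p / Z_p
   with x |-> exp (2 pi i x) on Z[1/p]. *)
Definition padic_e (R : realType) (p : nat) (p_pr : prime p)
    (x : padic p_pr) : R[i] :=
  expi (2 * pi * ratr (frac_part x)).

Definition padic_abs (R : realType) (p : nat) (m : int) : R :=
  if m == 0 then 0 else p%:R ^- logn p `|m|%N.

(* x ^ (-1/2), with value +oo at 0 (poweR and powR give 0 there). *)
Definition inv_sqrt (R : realType) (x : R) : \bar R :=
  if x == 0 then +oo%E else ((Num.sqrt x)^-1)%:E.

Definition unip (A : nzRingType) (m : nat) : set 'M[A]_m :=
  [set u | (forall i, u i i = 1) /\ (forall i j : 'I_m, (j < i)%N -> u i j = 0)].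

Definition intmx (A : nzRingType) (m : nat) (w : 'M[int]_m) : 'M[A]_m :=
  map_mx intr w.

(* U_w = U `&` w^-1 U^T w. *)
Definition unip_w (A : comUnitRingType) (m : nat) (w : 'M[int]_m) :
    set 'M[A]_m :=
  @unip A m `&`
  [set invmx (intmx A w) *m b^T *m intmx A w | b in @unip A m].

Section Kloosterman.
Variables (R : realType) (p : nat) (p_pr : prime p) (n : nat).
Local Notation Zp := (padic_int p_pr).
Local Notation Qp := (padic p_pr).

Definition to_Qp (x : 'M[Zp]_n.+1) : 'M[Qp]_n.+1 := map_mx (@tofrac Zp) x.

Definition GL_Zp : set 'M[Qp]_n.+1 := to_Qp @` [set x | x \in unitmx].
Definition U_Zp : set 'M[Qp]_n.+1 := to_Qp @` @unip Zp n.+1.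
Definition Uw_Zp (w : 'M[int]_n.+1) : set 'M[Qp]_n.+1 :=
  to_Qp @` @unip_w Zp n.+1 w.

(* The entry u_jj is the one in row j and column j + 1. *)
Definition unip_char (psi : 'I_n -> int) (u : 'M[Qp]_n.+1) : R[i] :=
  padic_e R (\sum_(j < n)
    (psi j)%:~R * u (widen_ord (leqnSn n) j) (lift ord0 j)).

Definition C_set (N : 'M[Qp]_n.+1) : set 'M[Qp]_n.+1 :=
  [set u *m N *m v | u in @unip Qp n.+1 & v in @unip Qp n.+1] `&` GL_Zp.

Definition double_coset (w : 'M[int]_n.+1) (x : 'M[Qp]_n.+1) :
    set 'M[Qp]_n.+1 :=
  [set g *m x *m h | g in U_Zp & h in Uw_Zp w].

Definition X_set (w : 'M[int]_n.+1) (N : 'M[Qp]_n.+1) :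
    set (set 'M[Qp]_n.+1) :=
  double_coset w @` C_set N.

(* The pair (u(x), u'(x)). *)
Definition bruhat (w : 'M[int]_n.+1) (N x : 'M[Qp]_n.+1) :
    'M[Qp]_n.+1 * 'M[Qp]_n.+1 :=
  xget (1%:M, 1%:M)
    [set uv | [/\ @unip Qp n.+1 uv.1, @unip_w Qp n.+1 w uv.2
                & x = uv.1 *m N *m uv.2]].

(* Each summand is evaluated at a representative of the double coset: changing
   the representative multiplies u(x) on the left by U(Z_p) and u'(x) on the
   right by U_w(Z_p), on which both characters are trivial.  The set of double
   cosets is finite, and no summand is 0, so the finitely supported sum ranges
   over all of it. *)
Definition Kl (psi psi' : 'I_n -> int) (t : 'M[Qp]_n.+1) (w : 'M[int]_n.+1) :
    R[i] :=
  let N := t *m intmx Qp w in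
  \sum_(X \in X_set w N)
    (let x := xget 0 X in
     unip_char psi (bruhat w N x).1 * unip_char psi' (bruhat w N x).2).

(* r_k for 1 <= k <= n (r is indexed from 0), and 0 for k = 0 and k = n + 1. *)
Definition pad (r : 'I_n -> nat) (k : nat) : nat :=
  (\sum_(i < n | i.+1 == k) r i)%N.

Definition Cstar (r : 'I_n -> nat) : 'M[Qp]_n.+1 :=
  diag_mx (\row_(i < n.+1) (p%:R : Qp) ^ ((pad r i)%:Z - (pad r i.+1)%:Z)).

End Kloosterman.

Definition w_long (n : nat) : 'M[int]_n.+1 :=
  \matrix_(i, j) if (i + j == n)%N then (-1) ^+ (n - i) else 0.

(* Main.v *)
(* Let d be a diagonal matrix of units and d' = w_l^-1 d^-1 w_l.  The substitution
   x |-> d x d' permutes X(N), and d can be chosen so that it multiplies a single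
   entry u_jj by a unit y, one superdiagonal entry of u' by y^-1, and fixes the
   other superdiagonal entries.  Averaging over y replaces the terms by normalized
   Kloosterman sums in one variable, for which the fourth moment gives a power
   saving in the denominator of psi_j u_jj.

   There remain the x for which every u_jj is almost integral.  Here x is determined
   by v = u(x)^-1 modulo U(Z_p), and v k is lower triangular for some k in GL(Z_p),
   with diagonal prescribed by the r_k up to units.  Comparing minors of v with those
   of v without its first row and column gives, by induction on the size, at most
   (1 + sum r_k)^O(1) prod p^(r_k) such v, and a power less if the superdiagonal is
   almost integral. *)
From HB Require Import structures.
Require Import Defs.
From mathcomp Require Import all_boot all_order all_algebra.
From mathcomp Require Import all_classical all_reals all_analysis.
From mathcomp Require Import complex.
From mathcomp Require cyclic.
From mathcomp Require Import ring lra zify.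

Set Implicit Arguments.
Unset Strict Implicit.
Unset Printing Implicit Defensive.

Import Order.TTheory GRing.Theory Num.Theory.
Local Open Scope ring_scope.

(** * p-adic integers and numbers *)

(** Modulo p^m, the equation (x1 + x2)(x1 - x3)(x2 - x3) = 0 only forces some factor to be divisible
    by about p^(m/3). Hence the fourth moment gains p^(-m/12) per average; twelfth powers keep all
    exponents integral. The modulus p^m of an average is the common denominator of the two arguments
    of the one-variable sum, so it varies with x. It depends only on denominators, which the torus
    preserves, as does the first j with u_jj far from integral; the x are sorted by j and m, and
    each class is averaged over its own group of units. Let R be the sum of the r_k and D =
    [saving_den n]. The count with integral superdiagonal saves about p^(R/D). Allowing
    superdiagonal entries of denominator p^t costs p^(nt), so t is taken near R/(2nD): half of the
    saving survives, and every average gains about p^(-t/12), up to the loss caused by p dividing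
    psi_j. This gives a power saving of order 1/(nD), half of which absorbs the powers of R + 1. *)

Section Padic.
Variables (p : nat) (p_pr : prime p).
Local Notation Zp := (padic_int p_pr).
Local Notation Qp := (padic p_pr).
Implicit Types (z : Zp) (x y : Qp).

Let p_gt1 : (1 < p)%N := prime_gt1 p_pr.
Let pX_gt0 k : (0 < p ^ k)%N. Proof. by rewrite expn_gt0 ltnW. Qed.

Lemma residueM (z z' : Zp) k : (z * z') k = (z k * z' k %% p ^ k)%N.
Proof. by []. Qed.

Lemma residueD (z z' : Zp) k : (z + z') k = ((z k + z' k) %% p ^ k)%N.
Proof. by []. Qed.

Lemma residue_nat m k : (m%:R : Zp) k = (m %% p ^ k)%N.
Proof.
elim: m => [|m IH] //; rewrite -addn1 natrD residueD IH /=.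
by rewrite modnDm addn1.
Qed.

Lemma residue0 z : z 0%N = 0%N.
Proof. by rewrite -residue_mod expn0 modn1. Qed.

Lemma residue_lt z k : (z k < p ^ k)%N.
Proof. by rewrite -residue_mod ltn_mod. Qed.

Lemma padic_div_subproof z e k :
  ((z (e + k.+1) %/ p ^ e) %% p ^ k = z (e + k) %/ p ^ e)%N.
Proof.
by rewrite modn_divl -expnD [(k + e)%N]addnC addnS residue_compat.
Qed.

(** Drops the lowest [e] digits in base [p]; this is division by [p ^ e] when those digits
    vanish. *)
Definition padic_div z e : Zp := PadicInt p_pr (padic_div_subproof z e).

Lemma padic_divP z e : z e = 0%N -> z = p%:R ^+ e * padic_div z e.
Proof.
move=> z0; apply: padic_int_ext => k; rewrite residueM -natrX residue_nat /=.
rewrite modnMml -(residue_mod_le z (leq_addl e k)) [in RHS]mulnC divnK //.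
by rewrite /dvdn (residue_mod_le z (leq_addr k e)) z0.
Qed.

Lemma padic_residueE z e : exists z', z = (z e)%:R + p%:R ^+ e * z'.
Proof.
have z0 : (z - (z e)%:R) e = 0%N.
  rewrite -[z - _]/(z + - _) residueD /= residue_nat residue_mod modnDmr.
  by rewrite subnKC ?modnn // ltnW // residue_lt.
by exists (padic_div (z - (z e)%:R) e); rewrite -padic_divP // addrC subrK.
Qed.

(** By Euler's theorem an inverse modulo [p ^ k] is the power of exponent [(totient (p ^ k)).-1].
    These residues are compatible because inverses modulo [p ^ k] are unique. *)
Lemma padic_unitE z : (z \is a GRing.unit) = (z 1 != 0)%N.
Proof.
apply/idP/idP.
  move=> /unitrP[y [_ /(congr1 (fun t : Zp => t 1%N))]].
  rewrite residueM -[1]/(1%:R : Zp) residue_nat expn1 (modn_small p_gt1).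
  by case: (z 1%N =P 0%N) => // ->; rewrite mul0n mod0n.
move=> z1.
have cop k : coprime (z k) (p ^ k).
  case: k => [|k]; first by rewrite expn0 coprimen1.
  rewrite coprime_sym coprime_pexpl // prime_coprime //.
  by rewrite /dvdn -[X in (_ %% X)%N]expn1 residue_mod_le.
pose f k := (z k ^ (totient (p ^ k)).-1 %% p ^ k)%N.
have fP k : (f k * z k %% p ^ k = 1 %% p ^ k)%N.
  by rewrite /f modnMml -expnSr prednK ?totient_gt0 // cyclic.Euler_exp_totient.
have fc k : (f k.+1 %% p ^ k = f k)%N.
  have dv : (p ^ k %| p ^ k.+1)%N by rewrite dvdn_exp2l.
  rewrite -[RHS](@modn_small (f k) (p ^ k)) ?ltn_mod //.
  have e1 : (f k.+1 * z k = 1 %[mod p ^ k])%N.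
    by rewrite -(residue_compat z k) modnMmr -(modn_dvdm _ dv) fP modn_dvdm.
  rewrite -[f k.+1]muln1 -modnMmr -(fP k) modnMmr mulnCA -modnMmr e1 modnMmr muln1.
  by rewrite modn_mod.
apply/unitrP; exists (PadicInt p_pr fc).
have e : PadicInt p_pr fc * z = 1.
  by apply: padic_int_ext => k; rewrite residueM fP -[1]/(1%:R : Zp) residue_nat.
by split; rewrite // mulrC.
Qed.

End Padic.

Lemma divf_common (F : fieldType) (a b c d : F) : b != 0 -> d != 0 ->
  a * c / (b * d) * b = a * (c / d).
Proof. by move=> b0 d0; field; rewrite b0 d0. Qed.

Lemma divf_cross (F : fieldType) (a b c d e u v : F) :
  b != 0 -> d != 0 -> v != 0 -> a * d = c * b * e -> a * u / b = c * v / d * (e * (u / v)).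
Proof.
move=> b0 d0 v0 h; have -> : a = c * b * e / d by rewrite -h mulfK.
by field; rewrite b0 d0 v0.
Qed.

Section PadicNumbers.
Variables (p : nat) (p_pr : prime p).
Local Notation Zp := (padic_int p_pr).
Local Notation Qp := (padic p_pr).
Implicit Types (z : Zp) (x y : Qp).

Let p_gt1 : (1 < p)%N := prime_gt1 p_pr.
Let pX_gt0 k : (0 < p ^ k)%N. Proof. by rewrite expn_gt0 ltnW. Qed.

Definition pint : {pred Qp} := fun x => `[< exists z : Zp, x = tofrac z >].

Lemma pintP x : reflect (exists z : Zp, x = tofrac z) (x \in pint).
Proof. exact: asboolP. Qed.

Lemma pint_tofrac z : tofrac z \in pint.
Proof. by apply/pintP; exists z. Qed.

Fact pint_subring : subring_closed pint.
Proof.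
split; first by rewrite -tofrac1 pint_tofrac.
  by move=> _ _ /pintP[a ->] /pintP[b ->]; rewrite -tofracB pint_tofrac.
by move=> _ _ /pintP[a ->] /pintP[b ->]; rewrite -tofracM pint_tofrac.
Qed.

HB.instance Definition _ := GRing.isSubringClosed.Build Qp pint pint_subring.

Definition punit : {pred Qp} := [pred x | [&& x != 0, x \in pint & x^-1 \in pint]].

Lemma punit_neq0 x : x \in punit -> x != 0. Proof. by case/and3P. Qed.
Lemma punit_int x : x \in punit -> x \in pint. Proof. by case/and3P. Qed.
Lemma punitV x : x \in punit -> x^-1 \in punit.
Proof. by case/and3P=> x0 xi xV; rewrite inE invr_eq0 x0 xV invrK. Qed.
Lemma punitM x y : x \in punit -> y \in punit -> x * y \in punit.
Proof.
case/and3P=> x0 xi xV /and3P[y0 yi yV].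
by rewrite inE mulf_neq0 //= rpredM //= invfM rpredM.
Qed.
Lemma punit1 : 1 \in punit.
Proof. by rewrite inE oner_eq0 invr1 rpred1. Qed.

Lemma punit_sign k : (-1) ^+ k \in punit.
Proof. by rewrite inE signr_eq0 -exprVn invrN1 rpredX ?rpredN ?rpred1. Qed.

Lemma pint_mulr_unit x y : y \in punit -> (x * y \in pint) = (x \in pint).
Proof.
case/and3P=> y0 yi yV; apply/idP/idP => [h|h]; last by rewrite rpredM.
by rewrite -(mulfK y0 x) rpredM.
Qed.

Lemma punit_tofrac z : z \is a GRing.unit -> tofrac z \in punit.
Proof.
move=> zu; have e : tofrac z * tofrac z^-1 = 1 :> Qp.
  by rewrite -tofracM divrr // tofrac1.
have z0 : tofrac z != 0 :> Qp.
  by apply/eqP => e0; move/eqP: e; rewrite e0 mul0r eq_sym oner_eq0.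
rewrite inE z0 pint_tofrac /=.
by rewrite -[_^-1]mulr1 -e mulKf // pint_tofrac.
Qed.

Lemma punitP x : x \in punit -> exists2 z, z \is a GRing.unit & x = tofrac z.
Proof.
case/and3P=> x0 /pintP[z xz] /pintP[z' xz']; exists z => //.
apply/unitrP; exists z'.
have e : z' * z = 1.
  by apply/eqP; rewrite -(tofrac_eq (z' * z)) tofracM -xz -xz' mulVf // tofrac1.
by split; rewrite // mulrC.
Qed.

Lemma natr_padic_neq0 m : (0 < m)%N -> m%:R != 0 :> Qp.
Proof.
move=> m0; rewrite -(rmorph_nat (@tofrac Zp)) tofrac_eq0.
apply/eqP => /(congr1 (fun t : Zp => t m)).
rewrite residue_nat (modn_small (ltn_expl m p_gt1)).
have -> : (0 : Zp) m = 0%N by exact: mod0n.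
by move=> m1; rewrite m1 in m0.
Qed.

Lemma p_neq0 : p%:R != 0 :> Qp.
Proof. by rewrite natr_padic_neq0 // ltnW. Qed.

Lemma pX_neq0 k : p%:R ^+ k != 0 :> Qp.
Proof. by rewrite expf_neq0 // p_neq0. Qed.

Lemma pint_pX k : p%:R ^+ k \in pint.
Proof. by rewrite rpredX // rpred_nat. Qed.

(** Take the last [k] for which [z] vanishes modulo [p ^ k]: after removing [k] digits the residue
    modulo [p] is nonzero. *)
Lemma tofrac_decomp z : z != 0 ->
  exists k, exists2 u, u \in punit & tofrac z = p%:R ^+ k * u.
Proof.
move=> z0; have ex : exists k, z k != 0%N.
  case: (pselect (exists k, z k != 0%N)) => // /forallNP h; case/eqP: z0.
  apply: padic_int_ext => k; have /negP := h k; rewrite negbK => /eqP ->.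
  by symmetry; exact: mod0n.
case: (ex_minnP ex) => -[|k] zk mink; first by rewrite residue0 in zk.
have z0k : z k = 0%N.
  by apply/eqP; apply: contraT => /mink; rewrite ltnn.
exists k; exists (tofrac (padic_div z k)); last first.
  by rewrite {1}(padic_divP z0k) tofracM tofracXn rmorph_nat.
apply: punit_tofrac; rewrite padic_unitE /= addn1.
apply: contra zk; rewrite -leqn0 leqNgt divn_gt0 // -ltnNge => lt.
by rewrite -(modn_small lt) residue_compat z0k.
Qed.

Lemma frac_numden x : exists z, exists2 d : Zp, d != 0 & x = tofrac z / tofrac d.
Proof.
elim/quotW: x => r; exists (frac r).1; exists (frac r).2; first exact: denom_ratioP.
have d0 : tofrac (frac r).2 != 0 :> Qp by rewrite tofrac_eq0 denom_ratioP.
apply: (mulIf d0); rewrite divfK //; apply/eqP.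
rewrite -[_ * _]/(FracField.mul _ _) !piE /FracField.equivf /FracField.mulf /=.
by rewrite !numden_Ratio ?mulr1 ?oner_neq0 ?denom_ratioP // mulrC.
Qed.

(** The valuation is [k - m]; two natural exponents avoid integer powers. *)
Lemma padic_decomp x : x != 0 -> exists m k,
  exists2 u, u \in punit & x * p%:R ^+ m = p%:R ^+ k * u.
Proof.
have [z [d d0 ->]] := frac_numden x => x0.
have z0 : z != 0 by apply: contra x0 => /eqP ->; rewrite tofrac0 mul0r.
have [k [u uu ->]] := tofrac_decomp z0; have [m [v vu ->]] := tofrac_decomp d0.
exists m; exists k; exists (u / v); first by rewrite punitM ?punitV.
by rewrite divf_common ?pX_neq0 ?(punit_neq0 vu).
Qed.

Lemma pint_exists_den x : exists k, x * p%:R ^+ k \in pint.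
Proof.
have [->|x0] := eqVneq x 0; first by exists 0%N; rewrite mul0r rpred0.
have [m [k [u uu e]]] := padic_decomp x0.
by exists m; rewrite e rpredM ?pint_pX ?punit_int.
Qed.

(** Z_p is a valuation ring. This is what provides a pivot in the elimination behind [iwasawa]. *)
Lemma pint_total x y : (exists2 z, z \in pint & x = y * z) \/
                       (exists2 z, z \in pint & y = x * z).
Proof.
have [->|x0] := eqVneq x 0; first by left; exists 0; rewrite ?mulr0 ?rpred0.
have [->|y0] := eqVneq y 0; first by right; exists 0; rewrite ?mulr0 ?rpred0.
have [m [k [u uu e]]] := padic_decomp x0; have [m' [k' [v vu e']]] := padic_decomp y0.
have {}e : x = p%:R ^+ k * u / p%:R ^+ m by rewrite -e mulfK ?pX_neq0.
have {}e' : y = p%:R ^+ k' * v / p%:R ^+ m' by rewrite -e' mulfK ?pX_neq0.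
have [u0 v0] := (punit_neq0 uu, punit_neq0 vu).
case: (leqP (k' + m) (k + m')) => [/subnKC|/ltnW/subnKC] h; [left|right].
  exists (p%:R ^+ (k + m' - (k' + m)) * (u / v)).
    by rewrite rpredM ?pint_pX ?punit_int // punitM ?punitV.
  have : p%:R ^+ (k + m') = p%:R ^+ (k' + m + (k + m' - (k' + m))) :> Qp by rewrite h.
  by rewrite !exprD e e'; apply: divf_cross; rewrite ?pX_neq0.
exists (p%:R ^+ (k' + m - (k + m')) * (v / u)).
  by rewrite rpredM ?pint_pX ?punit_int // punitM ?punitV.
have : p%:R ^+ (k' + m) = p%:R ^+ (k + m' + (k' + m - (k + m'))) :> Qp by rewrite h.
by rewrite !exprD e e'; apply: divf_cross; rewrite ?pX_neq0.
Qed.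

(* |x|_p <= p ^ m iff pden x <= m. *)
Definition pden x : nat :=
  ex_minn (P := fun m => x * p%:R ^+ m \in pint) (pint_exists_den x).

Lemma pdenP x m : (x * p%:R ^+ m \in pint) = (pden x <= m)%N.
Proof.
rewrite /pden; case: ex_minnP => k xk mink; apply/idP/idP; first exact: mink.
by move=> /subnKC <-; rewrite exprD mulrA rpredM ?pint_pX.
Qed.

Lemma pden_eq x y : (forall m, (x * p%:R ^+ m \in pint) = (y * p%:R ^+ m \in pint)) ->
  pden x = pden y.
Proof.
move=> h; apply/eqP; rewrite eqn_leq; apply/andP; split.
  by rewrite -pdenP h pdenP.
by rewrite -pdenP -h pdenP.
Qed.

Lemma pden_addr x y : y \in pint -> pden (x + y) = pden x.
Proof.
move=> yi; apply: pden_eq => m; rewrite mulrDl rpredDr //.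
by rewrite rpredM ?pint_pX.
Qed.

Lemma pden_mulr_unit x y : y \in punit -> pden (x * y) = pden x.
Proof. by move=> yu; apply: pden_eq => m; rewrite mulrAC (pint_mulr_unit _ yu). Qed.

Lemma pden_opp x : pden (- x) = pden x.
Proof. by apply: pden_eq => m; rewrite mulNr rpredN. Qed.

Lemma pint_pXV m : (p%:R ^- m \in pint) = (m == 0%N).
Proof.
case: m => [|m]; first by rewrite expr0 invr1 rpred1.
apply/negP => /pintP[z e].
have : p%:R ^+ m.+1 * z = 1.
  apply/eqP; rewrite -(tofrac_eq (p%:R ^+ m.+1 * z)) tofracM tofracXn rmorph_nat -e.
  by rewrite mulfV ?pX_neq0 // tofrac1.
move/(congr1 (fun t : Zp => t 1%N)); rewrite exprS -mulrA residueM residue_nat expn1 modnn.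
by rewrite mul0n mod0n -[1]/(1%:R : Zp) residue_nat expn1 modn_small.
Qed.

(** If the result were not a unit, it would be divisible by [p], and a smaller power would already
    clear the denominator. *)
Lemma punit_minden x m : (0 < m)%N -> x * p%:R ^+ m \in pint ->
  x * p%:R ^+ m.-1 \notin pint -> x * p%:R ^+ m \in punit.
Proof.
case: m => // m _ /= xi; apply: contraR => nu.
have [z' ze] := pintP _ xi.
have zu : z' 1%N = 0%N.
  apply/eqP; apply: contraR nu => z1; rewrite ze punit_tofrac //.
  by rewrite padic_unitE.
have : x * p%:R ^+ m = tofrac (padic_div z' 1).
  apply: (mulIf p_neq0); rewrite -mulrA -exprSr ze {1}(padic_divP zu) expr1.
  by rewrite tofracM rmorph_nat mulrC.
by move=> ->; exact: pint_tofrac.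
Qed.

End PadicNumbers.
Arguments pint {p p_pr}.
Arguments punit {p p_pr}.

(** * The additive character *)

Section Expi.
Variable R : realType.
Local Notation C := R[i].

Lemma expiD (s t : R) : expi (s + t) = expi s * expi t.
Proof.
rewrite /expi; apply/eqP; rewrite eq_complex /=.
by rewrite cosD sinD [sin s * cos t + _]addrC !eqxx.
Qed.

Lemma expi0 : expi (0 : R) = 1.
Proof. by rewrite /expi cos0 sin0. Qed.

Lemma expiN (t : R) : expi (- t) = (expi t)^-1.
Proof.
have h : expi t * expi (- t) = 1 by rewrite -expiD subrr expi0.
have t0 : expi t != 0.
  by apply/eqP => e; move/eqP: h; rewrite e mul0r eq_sym oner_eq0.
by apply: (mulfI t0); rewrite h mulfV.
Qed.

Lemma norm_expi (t : R) : `|expi t| = 1.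
Proof. by rewrite normc_def /= cos2Dsin2 sqrtr1. Qed.

Lemma expi_nat n : expi (2 * pi * n%:R : R) = 1.
Proof.
elim: n => [|n IH]; first by rewrite mulr0 expi0.
rewrite -(natr1 n) mulrDr expiD IH mul1r mulr1.
by rewrite mulr_natl /expi cos2pi sin2pi.
Qed.

Lemma expi_int (m : int) : expi (2 * pi * m%:~R : R) = 1.
Proof.
case: m => n; first exact: expi_nat.
by rewrite NegzE mulrNz mulrN expiN expi_nat invr1.
Qed.

(** The real part is 1 - 2 sin(pi t)^2, and the sine is positive on the open interval from 0 to
    pi. *)
Lemma expi_neq1 (t : R) : 0 < t -> t < 1 -> expi (2 * pi * t) != 1.
Proof.
move=> t0 t1; apply/eqP => /(congr1 (@complex.Re R)) /=.
rewrite -mulrA [2 * _]mulr_natl cos_mulr2n.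
have /lt0r_neq0 : 0 < sin (pi * t) by rewrite sin_gt0_pi // mulr_gt0 ?pi_gt0 //= gtr_pMr ?pi_gt0.
by rewrite -sqrf_eq0 sin2cos2 => /eqP h e; apply: h; move: e; rewrite mulr2n; lra.
Qed.

End Expi.

Lemma opprB_common (V : zmodType) (x y z : V) : x - y - (x - z) = z - y.
Proof. by rewrite opprB addrC addrA subrK. Qed.

Lemma sub_div_common (F : fieldType) (a b c d : F) : b != 0 -> d != 0 ->
  a / b - c / d = (a * d - c * b) / (b * d).
Proof. by move=> b0 d0; field; rewrite b0 d0. Qed.

Lemma add_div_common (F : fieldType) (a b c d : F) : b != 0 -> d != 0 ->
  a / b + c / d = (a * d + c * b) / (b * d).
Proof. by move=> b0 d0; field; rewrite b0 d0. Qed.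

Section Char.
Variables (R : realType) (p : nat) (p_pr : prime p).
Local Notation Zp := (padic_int p_pr).
Local Notation Qp := (padic p_pr).
Implicit Types (z : Zp) (x y : Qp) (q : rat).
Let p_gt1 : (1 < p)%N := prime_gt1 p_pr.

Lemma ratr_padic q (a : int) k : q * p%:R ^+ k = a%:~R ->
  ratr q = a%:~R / p%:R ^+ k :> Qp.
Proof.
move=> e; rewrite /ratr.
have d0 : (denq q)%:~R != 0 :> Qp.
  by rewrite -absz_denq -pmulrn natr_padic_neq0 // absz_gt0 denq_neq0.
have h : numq q * (p ^ k)%:Z = a * denq q.
  apply/eqP; rewrite -(eqr_int rat) !intrM numqE -e mulrAC.
  by rewrite -pmulrn natrX.
apply/eqP; rewrite eqr_div ?pX_neq0 //; apply/eqP.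
by rewrite -natrX [(p ^ k)%:R]pmulrn -!intrM h.
Qed.

Lemma is_frac_partE x q : is_frac_part x q <->
  exists k (a : int), q = a%:~R / p%:R ^+ k /\ x - a%:~R / p%:R ^+ k \in pint.
Proof.
have p0 k : p%:R ^+ k != 0 :> rat by rewrite expf_neq0 // pnatr_eq0 -lt0n ltnW.
split.
  move=> [[k /intrP[a qa]] [z xz]]; exists k; exists a; split.
    by rewrite -qa mulfK.
  by rewrite xz -(ratr_padic qa) addrC addKr pint_tofrac.
move=> [k [a [-> /pintP[z xz]]]]; split.
  by exists k; rewrite divfK // intr_int.
exists z; rewrite -xz (@ratr_padic _ a k) ?divfK //.
by rewrite addrC subrK.
Qed.

Lemma pint_intr_div (c : int) k : c%:~R / p%:R ^+ k \in @pint p p_pr ->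
  exists d : int, c = d * (p ^ k)%:Z.
Proof.
wlog [m ->] : c / exists m : nat, c = m.
  move=> h ci; case: (intP c) ci => [|m|m] ci; first by exists 0; rewrite mul0r.
    by apply: h ci; exists m.+1.
  have [|d ->] := h m.+1%:Z (ex_intro _ _ erefl); last by exists (- d); rewrite mulNr.
  by move: ci; rewrite mulrNz mulNr rpredN.
move=> /pintP[z /(congr1 (fun t => t * p%:R ^+ k))]; rewrite divfK ?pX_neq0 //.
rewrite -pmulrn -(rmorph_nat (@tofrac Zp) m) -(rmorph_nat (@tofrac Zp) p).
rewrite -tofracXn -tofracM => /eqP; rewrite tofrac_eq => /eqP.
move=> /(congr1 (fun t : Zp => t k)); rewrite residueM -natrX !residue_nat modnn muln0 mod0n.
by move=> /eqP/dvdnP[d ->]; exists d; rewrite PoszM.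
Qed.

Lemma frac_part_uniq x q q' : is_frac_part x q -> is_frac_part x q' ->
  q - q' \is a Num.int.
Proof.
have p0 k : p%:R ^+ k != 0 :> rat by rewrite expf_neq0 // pnatr_eq0 -lt0n ltnW.
move=> /is_frac_partE[k [a [-> xa]]] /is_frac_partE[k' [a' [-> xa']]].
have := rpredB xa' xa; rewrite [x - _ - _]opprB_common.
have -> : a%:~R / p%:R ^+ k - a'%:~R / p%:R ^+ k' =
    (a * (p ^ k')%:Z - a' * (p ^ k)%:Z)%:~R / p%:R ^+ (k + k') :> Qp.
  by rewrite intrB !intrM -!pmulrn !natrX exprD; apply: sub_div_common; rewrite pX_neq0.
move=> /pint_intr_div[d /(congr1 (fun t : int => t%:~R : rat))].
rewrite intrB !intrM -!pmulrn !natrX exprD => h.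
apply/intrP; exists d; rewrite sub_div_common // h mulfK //.
by rewrite mulf_neq0.
Qed.

Lemma pint_residueE z m : tofrac z / p%:R ^+ m - (z m)%:R / p%:R ^+ m \in @pint p p_pr.
Proof.
have [z' e] := padic_residueE z m.
have -> : tofrac z = (z m)%:R + p%:R ^+ m * tofrac z' :> Qp.
  by rewrite {1}e tofracD tofracM tofracXn !rmorph_nat.
by rewrite -mulrBl addrC addKr mulrC mulKf ?pX_neq0 // pint_tofrac.
Qed.

Lemma frac_part_ex x : exists q, is_frac_part x q.
Proof.
have [m /pintP[z xz]] := pint_exists_den x.
exists ((z m)%:~R / p%:R ^+ m); apply/is_frac_partE; exists m; exists (z m); split=> //.
have -> : x = tofrac z / p%:R ^+ m by rewrite -xz mulfK ?pX_neq0.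
by rewrite -pmulrn pint_residueE.
Qed.

(** Fractional parts differ by integers, so the one chosen by [xget] can be replaced by any
    convenient one. *)
Lemma padic_eE x q : is_frac_part x q -> padic_e R x = expi (2 * pi * ratr q).
Proof.
move=> xq; rewrite /padic_e.
have /(frac_part_uniq xq)/intrP[m] : is_frac_part x (frac_part x).
  by rewrite /frac_part; apply: (@xgetPex _ 0 [set q | is_frac_part x q]%classic); exists q.
move=> /(canRL (subrK _)) ->.
by rewrite [ratr (_ + _)](rmorphD (@ratr R)) /= ratr_int (mulrDr _ m%:~R) expiD expi_int mul1r.
Qed.

Lemma padic_eD x y : padic_e R (x + y) = padic_e R x * padic_e R y.
Proof.
have [q xq] := frac_part_ex x; have [q' yq'] := frac_part_ex y.
rewrite (padic_eE xq) (padic_eE yq') -expiD -[in RHS]mulrDr -[ratr _ + _](rmorphD (@ratr R)) /=.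
apply: padic_eE; move/is_frac_partE: xq => [k [a [-> xa]]].
move/is_frac_partE: yq' => [k' [a' [-> ya]]].
have p0 j : p%:R ^+ j != 0 :> rat by rewrite expf_neq0 // pnatr_eq0 -lt0n ltnW.
apply/is_frac_partE; exists (k + k')%N; exists (a * (p ^ k')%:Z + a' * (p ^ k)%:Z).
rewrite !intrD !intrM -!pmulrn !natrX !exprD -!add_div_common ?pX_neq0 //.
by split=> //; rewrite opprD addrACA rpredD.
Qed.

Lemma padic_e_int x : x \in pint -> padic_e R x = 1.
Proof.
move=> xi; rewrite (@padic_eE _ 0) ?rmorph0 ?mulr0 ?expi0 //.
by apply/is_frac_partE; exists 0%N; exists 0; rewrite !mul0r subr0.
Qed.

Lemma norm_padic_e x : `|padic_e R x| = 1.
Proof. exact: norm_expi. Qed.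

Lemma padic_e_residue z m :
  padic_e R (tofrac z / p%:R ^+ m) = expi (2 * pi * ((z m)%:R / (p ^ m)%:R)).
Proof.
rewrite (@padic_eE _ ((z m)%:R / (p ^ m)%:R)); first by rewrite fmorph_div /= !ratr_nat.
apply/is_frac_partE; exists m; exists (z m); split; first by rewrite natrX.
by rewrite -pmulrn pint_residueE.
Qed.

End Char.

(** * Kloosterman's fourth moment bound *)

Section FourthMoment.
Variables (C : numClosedFieldType) (A : finComUnitRingType) (chi : A -> C).
Hypothesis chiD : forall x y, chi (x + y) = chi x * chi y.
Hypothesis norm_chi : forall x, `|chi x| = 1.
Hypothesis chi_sum : forall a, a != 0 -> \sum_t chi (t * a) = 0.

Let chi_neq0 x : chi x != 0.
Proof. by rewrite -normr_eq0 norm_chi oner_eq0. Qed.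

Let chi0 : chi 0 = 1.
Proof. by apply: (mulfI (chi_neq0 0)); rewrite -chiD addr0 mulr1. Qed.

Let conj_chi x : (chi x)^* = chi (- x).
Proof.
apply: (mulfI (chi_neq0 x)); rewrite -chiD subrr chi0.
by rewrite -normCK norm_chi expr1n.
Qed.

Let chi_sumE a : \sum_t chi (t * a) = (#|A| * (a == 0))%:R.
Proof.
have [->|a0] := eqVneq a 0; last by rewrite muln0 chi_sum.
rewrite muln1 (eq_bigr (fun=> 1)); first by rewrite sumr_const.
by move=> t _; rewrite mulr0 chi0.
Qed.

(** Orthogonality in [a] and in [b]: after opening the square, only pairs with equal [f] and equal
    [g] survive. *)
Lemma char_parseval (I : finType) (D : pred I) (f g : I -> A) :
  \sum_a \sum_b `|\sum_(i | D i) chi (a * f i + b * g i)| ^+ 2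
  = (#|A| ^ 2 * #|[set ij : I * I | [&& D ij.1, D ij.2, f ij.1 == f ij.2
                                     & g ij.1 == g ij.2]]|)%:R.
Proof.
pose DD (ij : I * I) := D ij.1 && D ij.2.
have sq a b : `|\sum_(i | D i) chi (a * f i + b * g i)| ^+ 2 =
    \sum_(ij | DD ij) chi (a * (f ij.1 - f ij.2)) * chi (b * (g ij.1 - g ij.2)).
  rewrite normCK rmorph_sum big_distrlr pair_big /=; apply: eq_bigr => ij _.
  by rewrite conj_chi -chiD opprD addrACA -!mulrBr chiD.
transitivity (\sum_(ij | DD ij) \sum_a \sum_b
    chi (a * (f ij.1 - f ij.2)) * chi (b * (g ij.1 - g ij.2))).
  rewrite [RHS]exchange_big /=; apply: eq_bigr => a _; rewrite [RHS]exchange_big /=.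
  by apply: eq_bigr => b _; rewrite sq.
rewrite (eq_bigr (fun ij => (#|A| * (f ij.1 - f ij.2 == 0%R))%:R *
                            (#|A| * (g ij.1 - g ij.2 == 0%R))%:R)); last first.
  by move=> ij _; rewrite -big_distrlr /= !chi_sumE.
rewrite (bigID (fun ij => (f ij.1 == f ij.2) && (g ij.1 == g ij.2))) /=.
rewrite [X in _ + X]big1 ?addr0; last first.
  move=> ij /andP[_]; rewrite !subr_eq0.
  by case: eqP => _ //=; rewrite ?muln0 ?mul0r // => /negPf ->; rewrite muln0 mulr0.
rewrite (eq_bigr (fun=> (#|A| ^ 2)%:R)); last first.
  by move=> ij /andP[_ /andP[/eqP-> /eqP->]]; rewrite !subrr eqxx !muln1 -natrM.
rewrite sumr_const natrM -[LHS]mulr_natr; congr (_ * _%:R).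
by apply: eq_card => ij; rewrite !inE unfold_in /DD -andbA.
Qed.

Definition ksum (a b : A) : C := \sum_(y | y \is a GRing.unit) chi (a * y + b * y^-1).

Definition kquads : {set (A * A) * (A * A)} :=
  [set ij | [&& (ij.1.1 \is a GRing.unit) && (ij.1.2 \is a GRing.unit),
                (ij.2.1 \is a GRing.unit) && (ij.2.2 \is a GRing.unit),
                ij.1.1 + ij.1.2 == ij.2.1 + ij.2.2
              & ij.1.1^-1 + ij.1.2^-1 == ij.2.1^-1 + ij.2.2^-1]].

(** The square of a Kloosterman sum is a character sum over pairs of units with frequencies x1 + x2
    and 1/x1 + 1/x2, so Parseval counts coincidences between two such pairs. *)
Lemma ksum_fourth : \sum_a \sum_b `|ksum a b| ^+ 4 = (#|A| ^ 2 * #|kquads|)%:R.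
Proof.
rewrite -(char_parseval (fun i => (i.1 \is a GRing.unit) && (i.2 \is a GRing.unit))
  (fun i => i.1 + i.2) (fun i => i.1^-1 + i.2^-1)).
apply: eq_bigr => a _; apply: eq_bigr => b _.
rewrite (exprM _ 2 2) -normrX; congr (`| _ | ^+ 2).
rewrite expr2 big_distrlr pair_big /=; apply: eq_bigr => ij _.
by rewrite -chiD !mulrDr addrACA.
Qed.

Lemma ksum_twist a b y : y \is a GRing.unit -> ksum (a * y) (b * y^-1) = ksum a b.
Proof.
move=> yu; rewrite /ksum [RHS](reindex_inj (mulrI yu)) /=.
apply: eq_big => [x|x xu]; first by rewrite unitrMr.
by rewrite invrM // [x^-1 * _]mulrC !mulrA.
Qed.

(* The sums ksum (a y) (b / y), for y a unit, are all equal and have distinct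
   parameters. *)
Lemma ksum_bound a b : (a \is a GRing.unit) || (b \is a GRing.unit) ->
  `|ksum a b| ^+ 4 * #|[pred y : A | y \is a GRing.unit]|%:R
    <= (#|A| ^ 2 * #|kquads|)%:R.
Proof.
move=> abu; rewrite -ksum_fourth pair_big /= mulr_natr -sumr_const.
rewrite (eq_bigr (fun y : A => `|ksum (a * y) (b * y^-1)| ^+ 4)); last first.
  by move=> y yu; rewrite ksum_twist.
pose h (y : A) := (a * y, b * y^-1).
have h_inj : {in [pred y : A | y \is a GRing.unit] &, injective h}.
  move=> y y' _ _ [e1 e2]; case/orP: abu => [au|bu]; first exact: (mulrI au).
  exact/invr_inj/(mulrI bu).
rewrite -(big_imset (fun ab : A * A => `|ksum ab.1 ab.2| ^+ 4) h_inj) /=.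
rewrite [leRHS](bigID (mem [set h y | y in [pred y : A | y \is a GRing.unit]])) /=.
by rewrite lerDl sumr_ge0 // => ij _; rewrite exprn_ge0.
Qed.

Definition ktriples : {set A * A * A} :=
  [set t | (t.1.1 + t.1.2) * (t.1.1 - t.2) * (t.1.2 - t.2) == 0].

(* Given the sum of x1, x2, equality of the sums of inverses amounts to
   (x1 + x2) * (x1 - x3) * (x2 - x3) = 0. *)
Lemma card_kquads : (#|kquads| <= #|ktriples|)%N.
Proof.
pose h (ij : (A * A) * (A * A)) := (ij.1, ij.2.1).
rewrite -(card_in_imset (f := h) (D := kquads)); last first.
  move=> [[x1 x2] [x3 x4]] [[y1 y2] [y3 y4]] /=.
  rewrite !inE /= => /and4P[_ _ /eqP e _] /and4P[_ _ /eqP e' _] [e1 e2 e3].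
  by move: e e'; rewrite e1 e2 e3 => -> /addrI ->.
apply/subset_leq_card/fintype.subsetP => _ /imsetP[[[x1 x2] [x3 x4]] + ->].
rewrite !inE /= => /and4P[/andP[u1 u2] /andP[u3 u4] /eqP e /eqP e'].
have {}e' : (x1 + x2) * (x3 * x4) = (x3 + x4) * (x1 * x2).
  have h' (x y : A) : x \is a GRing.unit -> y \is a GRing.unit ->
      x^-1 + y^-1 = (x + y) * (x * y)^-1.
    by move=> xu yu; rewrite invrM // mulrDl mulrCA divrr // mulr1 mulrA divrr // mul1r addrC.
  move: e'; rewrite !h' // => e'; rewrite -[x1 + x2](divrK (x := x1 * x2)) ?unitrM ?u1 //.
  by rewrite e' mulrAC divrK ?unitrM ?u3.
have e4 : x4 = x1 + x2 - x3 by rewrite e addrC addKr.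
apply/eqP; transitivity ((x3 + x4) * (x1 * x2) - (x1 + x2) * (x3 * x4)).
  by rewrite -e e4; ring.
by rewrite e' subrr.
Qed.

End FourthMoment.

(** * Kloosterman sums modulo prime powers *)

Section KloostermanZp.
Variables (C : numClosedFieldType) (p m : nat).
Hypotheses (p_pr : prime p) (m_gt0 : (0 < m)%N).
Local Notation q := (p ^ m)%N.
Local Notation A := 'Z_q.
Variable chi : A -> C.
Hypothesis chiD : forall x y, chi (x + y) = chi x * chi y.
Hypothesis norm_chi : forall x, `|chi x| = 1.
Hypothesis chi_neq1 : forall a, a != 0 -> chi a != 1.

Let p_gt1 : (1 < p)%N := prime_gt1 p_pr.
Let q_gt1 : (1 < q)%N.
Proof. by rewrite -(expn0 p) ltn_exp2l. Qed.

Let chi_sum a : a != 0 -> \sum_t chi (t * a) = 0.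
Proof.
move=> a0; pose S := \sum_t chi (t * a).
have : chi a * S = S.
  rewrite /S big_distrr /= [RHS](reindex_inj (addrI 1)) /=.
  by apply: eq_bigr => t _; rewrite mulrDl mul1r chiD.
move/eqP; rewrite -subr_eq0 -[X in _ - X]mul1r -mulrBl mulf_eq0 subr_eq0.
by rewrite (negPf (chi_neq1 a0)) => /eqP.
Qed.

Let card_A : #|A| = q. Proof. by rewrite card_ord Zp_cast. Qed.

Lemma card_dvdn_Zp c : (c <= m)%N -> #|[set t : A | (p ^ c %| t)%N]| = (p ^ (m - c))%N.
Proof.
move=> cm; have pc0 : (0 < p ^ c)%N by rewrite expn_gt0 ltnW.
have qE : q = (p ^ (m - c) * p ^ c)%N by rewrite -expnD subnK.
rewrite -[RHS]card_ord.
have lt (j : 'I_(p ^ (m - c))) : (j * p ^ c < (Zp_trunc q).+2)%N.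
  by rewrite Zp_cast // qE ltn_pmul2r.
pose h (j : 'I_(p ^ (m - c))) : A := Ordinal (lt j).
rewrite -cardsT -(card_imset (f := h)); last first.
  move=> i j /(congr1 val) /= /eqP; rewrite eqn_pmul2r // => /eqP; exact: val_inj.
apply: eq_card => t; rewrite inE; apply/idP/imsetP => [|[j _ ->]]; last by rewrite /= dvdn_mull.
move=> d; have lt' : (t %/ p ^ c < p ^ (m - c))%N.
  by rewrite ltn_divLR // -qE (leq_trans (ltn_ord t)) // Zp_cast.
by exists (Ordinal lt') => //; apply: val_inj; rewrite /= divnK.
Qed.

(** Otherwise each factor has valuation at most c - 1, and the product has valuation at most 3(c -
    1) < m. *)
Lemma dvdn_mul3_Zp c (x y z : A) : (3 * c.-1 < m)%N -> x * y * z = 0 ->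
  [|| (p ^ c %| x)%N, (p ^ c %| y)%N | (p ^ c %| z)%N].
Proof.
move=> cm xyz; apply: contraT; rewrite !negb_or => /and3P[nx ny nz].
have pos (t : A) : ~~ (p ^ c %| t)%N -> (0 < t)%N.
  by rewrite lt0n; apply: contra => /eqP ->.
have dv : (q %| x * y * z)%N.
  apply: (@dvdn_trans (Zp_trunc q).+2); first by rewrite Zp_cast.
  by move/(congr1 val): xyz => /=; rewrite modnMml => /eqP.
have [[x0 y0] z0] := (pos x nx, pos y ny, pos z nz).
move: dv nx ny nz; rewrite !pfactor_dvdn ?muln_gt0 ?x0 ?y0 ?z0 //.
rewrite !lognM ?muln_gt0 ?x0 ?y0 // -!ltnNge; lia.
Qed.

(** For each triple one of three linear forms is divisible by [p ^ c]. The value of the form and two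
    suitable coordinates determine the triple, which leaves at most q^2 p^(m - c) triples per
    form. *)
Lemma card_kquads_Zp c : (c <= m)%N -> (3 * c.-1 < m)%N ->
  (#|kquads A| <= 3 * (q ^ 2 * p ^ (m - c)))%N.
Proof.
move=> cm c3; apply: leq_trans (card_kquads _) _.
pose D := [set t : A | (p ^ c %| t)%N].
have cnt (h : A * A * A -> A) (g : A * A * A -> A * A * A) :
    injective g -> (forall t, (g t).2 = h t) ->
    (#|[set t | h t \in D]| <= q ^ 2 * p ^ (m - c))%N.
  move=> ginj gh; rewrite -(card_imset _ ginj) -(card_dvdn_Zp cm).
  have -> : (q ^ 2)%N = #|finset.setX [set: A] [set: A]| by rewrite cardsX !cardsT card_A mulnn.
  rewrite -cardsX.
  apply/subset_leq_card/fintype.subsetP => _ /imsetP[t + ->]; rewrite !inE => ht.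
  by rewrite gh ht.
pose h1 (t : A * A * A) := t.1.1 + t.1.2.
pose h2 (t : A * A * A) := t.1.1 - t.2.
pose h3 (t : A * A * A) := t.1.2 - t.2.
apply: (@leq_trans #|[set t | h1 t \in D] :|: [set t | h2 t \in D] :|: [set t | h3 t \in D]|).
  apply/subset_leq_card/fintype.subsetP => t; rewrite !inE => /eqP/(dvdn_mul3_Zp c3).
  by rewrite orbA.
apply: leq_trans (leq_card_setU _ _) _; rewrite !mulSn mul0n addn0 addnA.
apply: leq_add; first (apply: leq_trans (leq_card_setU _ _) _; apply: leq_add).
- apply: (cnt _ (fun t => (t.2, t.1.1, h1 t))) => // -[[a b] d] [[a' b'] d'].
  by rewrite /h1 /= => /eqP; rewrite !xpair_eqE => /andP[/andP[/eqP-> /eqP->] /eqP h]; rewrite (addrI _ h).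
- apply: (cnt _ (fun t => (t.1.1, t.1.2, h2 t))) => // -[[a b] d] [[a' b'] d'].
  by rewrite /h2 /= => /eqP; rewrite !xpair_eqE => /andP[/andP[/eqP-> /eqP->] /eqP h]; rewrite (oppr_inj (addrI _ h)).
- apply: (cnt _ (fun t => (t.1.1, t.1.2, h3 t))) => // -[[a b] d] [[a' b'] d'].
  by rewrite /h3 /= => /eqP; rewrite !xpair_eqE => /andP[/andP[/eqP-> /eqP->] /eqP h]; rewrite (oppr_inj (addrI _ h)).
Qed.

Lemma card_unit_Zp : #|[pred y : A | y \is a GRing.unit]| = totient q.
Proof.
rewrite totient_count_coprime -sum1_card big_mkcond /=.
transitivity (\sum_(0 <= i < (Zp_trunc q).+2) coprime q i)%N; last by rewrite Zp_cast.
rewrite big_mkord; apply: eq_bigr => y _; rewrite inE -{1}(natr_Zp y) unitZpE //.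
Qed.

Lemma leq_totient_pfactor : (q <= 2 * totient q)%N.
Proof.
rewrite totient_pfactor // -[m in (p ^ m)%N]prednK // expnS mulnA leq_mul2r.
by case: p p_gt1 => [|[|k]] // _; rewrite orbC /=; lia.
Qed.

(** The moment bound is |K|^4 totient(q) <= 3 q^4 p^(m - c). Multiplying by p^c gives 3 q^5, and q
    <= 2 totient(q) turns this into 3 * 2^5 = 96 times totient(q)^5. *)
Lemma ksum_Zp_bound c a b : (c <= m)%N -> (3 * c.-1 < m)%N ->
  (a \is a GRing.unit) || (b \is a GRing.unit) ->
  `|ksum chi a b| ^+ 4 * (p ^ c)%:R <= (96 * totient q ^ 4)%:R.
Proof.
move=> cm c3 /(ksum_bound chiD norm_chi chi_sum); rewrite card_unit_Zp card_A => h.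
have t0 : (0 : C) < (totient q)%:R by rewrite ltr0n totient_gt0 ltnW.
rewrite -(ler_pM2r t0) mulrAC; apply: le_trans (ler_wpM2r _ h) _; first exact: ler0n.
rewrite -!natrM ler_nat -[leqRHS]mulnA -expnSr.
apply: (@leq_trans (q ^ 2 * (3 * (q ^ 2 * p ^ (m - c))) * p ^ c)).
  by rewrite !leq_mul2r !leq_mul2l card_kquads_Zp // !orbT.
have AC (X a' b' : nat) : (X * (3 * (X * a')) * b' = 3 * (X * X * (a' * b')))%N by lia.
rewrite AC -[in X in (_ * (_ * X))%N]expnD subnK // -expnD -expnSr.
apply: (@leq_trans (3 * (2 * totient q) ^ 5)%N).
  by rewrite leq_mul2l leq_exp2r // leq_totient_pfactor.
by rewrite expnMn mulnA.
Qed.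

End KloostermanZp.

(** * Averages of the additive character over units *)

Section UnitAverage.
Variables (R : realType) (p : nat) (p_pr : prime p).
Local Notation Zp := (padic_int p_pr).
Local Notation Qp := (padic p_pr).
Local Notation C := R[i].
Let p_gt1 : (1 < p)%N := prime_gt1 p_pr.

Definition zp_char (q : nat) (t : 'Z_q) : C := expi (2 * pi * (t%:R / q%:R)).

Lemma expi_modn (a q : nat) : (0 < q)%N ->
  expi (2 * pi * ((a %% q)%N%:R / q%:R)) = expi (2 * pi * (a%:R / q%:R)) :> C.
Proof.
move=> q0; have -> : a%:R / q%:R = (a %/ q)%N%:R + (a %% q)%N%:R / q%:R :> R.
  by rewrite {1}(divn_eq a q) natrD natrM mulrDl mulfK // pnatr_eq0 -lt0n.
by rewrite (mulrDr _ (_ %/ _)%:R) expiD expi_nat mul1r.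
Qed.

Section Modulus.
Variable m : nat.
Hypothesis m_gt0 : (0 < m)%N.
Local Notation q := (p ^ m)%N.
Let q_gt1 : (1 < q)%N.
Proof. by rewrite -(expn0 p) ltn_exp2l. Qed.

Let zp_charE (a : nat) : zp_char (inZp a : 'Z_q) = expi (2 * pi * (a%:R / q%:R)).
Proof. by rewrite /zp_char /= [X in (a %% X)%N]Zp_cast // expi_modn // ltnW. Qed.

Lemma zp_charD (x y : 'Z_q) : zp_char (x + y) = zp_char x * zp_char y.
Proof.
have -> : x + y = inZp (x + y)%N :> 'Z_q by apply: val_inj.
by rewrite zp_charE natrD [(_ + _) / _]mulrDl (mulrDr _ (x%:R / _)) expiD.
Qed.

Lemma zp_char_neq1 (a : 'Z_q) : a != 0 -> zp_char a != 1.
Proof.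
have q0 : (0 : R) < q%:R by rewrite ltr0n ltnW.
move=> a0; apply: expi_neq1; last first.
  by rewrite ltr_pdivrMr // mul1r ltr_nat (leq_trans (ltn_ord a)) // Zp_cast.
by rewrite divr_gt0 // ltr0n lt0n; apply: contra a0 => /eqP h; apply/eqP/val_inj.
Qed.

Definition red (z : Zp) : 'Z_q := inZp (z m).

Lemma redD x y : red (x + y) = red x + red y.
Proof. by apply: val_inj => /=; rewrite !Zp_cast // modn_mod modnDm. Qed.

Lemma redM x y : red (x * y) = red x * red y.
Proof. by apply: val_inj => /=; rewrite !Zp_cast // modn_mod modnMm. Qed.

Lemma red_nat (a : nat) : red a%:R = inZp a.
Proof. by apply: val_inj; rewrite /= residue_nat !Zp_cast // modn_mod. Qed.

Lemma red1 : red 1 = 1.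
Proof. by rewrite -[1]/(1%:R) red_nat; apply: val_inj; rewrite /= Zp_cast. Qed.

Lemma redV z : z \is a GRing.unit -> red z \is a GRing.unit /\ red z^-1 = (red z)^-1.
Proof.
move=> zu; have e : red z^-1 * red z = 1 by rewrite -redM mulVr // red1.
have u : red z \is a GRing.unit by apply/unitrPr; exists (red z^-1); rewrite mulrC.
by split => //; apply: (mulIr u); rewrite e mulVr.
Qed.

Lemma padic_e_red z : padic_e R (tofrac z / p%:R ^+ m) = zp_char (red z).
Proof. by rewrite padic_e_residue zp_charE. Qed.

End Modulus.

(** The case [m = 0] is separate because ['Z_1] has two elements and is not Z/1. *)
Definition unit_reps (m : nat) : seq Zp :=
  if m is 0 then [:: 1]
  else [seq (nat_of_ord y)%:R | y <- enum [pred y : 'Z_(p ^ m) | y \is a GRing.unit]].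

Lemma unit_reps_unit m y : y \in unit_reps m -> y \is a GRing.unit.
Proof.
case: m => [|m] /=; first by rewrite inE => /eqP ->; rewrite unitr1.
have q1 : (1 < p ^ m.+1)%N by rewrite -(expn0 p) ltn_exp2l.
move=> /mapP[t]; rewrite mem_enum inE -{1}(natr_Zp t) unitZpE // => cop ->.
rewrite padic_unitE residue_nat expn1 -/(dvdn _ _) -prime_coprime //.
by rewrite coprime_pexpl in cop.
Qed.

Lemma size_unit_reps m : (0 < size (unit_reps m))%N.
Proof.
case: m => [|m] //=; rewrite size_map -cardE; apply/card_gt0P; exists 1.
by rewrite inE unitr1.
Qed.

(** The cube of [ksum_Zp_bound]: the normalized sum is at most 4 p^(-m/12), with no fractional
    exponent in the statement. *)
Lemma unit_average (al be : Qp) m : m = maxn (pden al) (pden be) ->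
  `|\sum_(y <- unit_reps m) padic_e R (al * tofrac y + be * tofrac y^-1)| ^+ 12 * (p ^ m)%:R
    <= ((4 * size (unit_reps m)) ^ 12)%:R.
Proof.
have [-> _|m0] := posnP m.
  by rewrite big_seq1 norm_padic_e expr1n mul1r expn0 ler_nat.
move=> mE.
have /pintP[a aE] : al * p%:R ^+ m \in pint by rewrite pdenP mE leq_maxl.
have /pintP[b bE] : be * p%:R ^+ m \in pint by rewrite pdenP mE leq_maxr.
have {}aE : al = tofrac a / p%:R ^+ m by rewrite -aE mulfK ?pX_neq0.
have {}bE : be = tofrac b / p%:R ^+ m by rewrite -bE mulfK ?pX_neq0.
have den_unit x z : x = tofrac z / p%:R ^+ m -> pden x = m -> red m z \is a GRing.unit.
  move=> xE xm; have : x * p%:R ^+ m \in punit.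
    apply: punit_minden; rewrite ?pdenP ?xm //.
    by rewrite -ltnNge prednK.
  rewrite xE divfK ?pX_neq0 // => /punitP[z' zu /eqP].
  by rewrite tofrac_eq => /eqP ->; have [] := redV m0 zu.
(* The larger of the two denominators is exactly [p ^ m], so its numerator is prime to [p]. *)
have abu : (red m a \is a GRing.unit) || (red m b \is a GRing.unit).
  move: mE; case: (leqP (pden al) (pden be)) => _ mE; apply/orP; [right|left].
    exact: den_unit bE (esym mE).
  exact: den_unit aE (esym mE).
(* The ceiling of m/3: the largest [c] with 3(c - 1) < m, and 3c >= m is what the cube requires. *)
pose c := ((m + 2) %/ 3)%N.
have cm : (c <= m)%N by rewrite /c; lia.
have c3 : (3 * c.-1 < m)%N by rewrite /c; lia.
have cc : (m <= 3 * c)%N by rewrite /c; lia.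
have := ksum_Zp_bound p_pr m0 (zp_charD m0) (fun x => norm_expi _) (zp_char_neq1 m0) cm c3 abu.
set S := ksum _ _ _; set S' := \sum_(y <- _) _.
have SS : S = S'.
  rewrite /S' /unit_reps; case: m m0 {cc c3 cm c den_unit S' abu mE} aE bE @S => // m m0 aE bE S.
  rewrite big_map big_enum; apply: eq_bigr => t tu.
  have tu' : (t : nat)%:R \is a @GRing.unit Zp.
    by apply: (@unit_reps_unit m.+1); apply/mapP; exists t; rewrite ?mem_enum.
  have rt : red m.+1 (t : nat)%:R = t.
    by rewrite red_nat //; apply: val_inj; rewrite /= modn_small ?ltn_ord.
  rewrite aE bE mulrAC [_ * tofrac _^-1]mulrAC -mulrDl -!tofracM -tofracD padic_e_red //.
  by rewrite redD // !redM // (redV m0 tu').2 rt.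
have -> : size (unit_reps m) = totient (p ^ m).
  rewrite /unit_reps -card_unit_Zp //; case: (m) m0 => // k _.
  by rewrite size_map -cardE.
rewrite SS => /(lerXn2r 3); rewrite !nnegrE mulr_ge0 ?ler0n ?exprn_ge0 // => /(_ isT isT).
rewrite exprMn -exprM -!natrX -expnM => h.
apply: le_trans (ler_wpM2l _ _) (le_trans h _); first by rewrite exprn_ge0.
  rewrite ler_nat; apply: leq_pexp2l; [exact: ltnW | by rewrite mulnC].
(* This is 96 <= 4^4, cubed. *)
have e k : ((96 * k ^ 4) ^ 3 <= (4 * k) ^ 12)%N.
  by rewrite (expnM _ 4 3) leq_exp2r // expnMn leq_mul2r orbC.
by rewrite ler_nat e.
Qed.

End UnitAverage.

(** * Counting classes *)

Section Covered.
Local Open Scope classical_set_scope.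

(* S meets at most B classes of E; members of L need not lie in S. *)
Definition covered (T : eqType) (E : T -> T -> Prop) (S : set T) (B : nat) :=
  exists L : seq T, (size L <= B)%N /\ forall x, S x -> exists2 l, l \in L & E x l.

Lemma covered_sub (T : eqType) (E : T -> T -> Prop) (S S' : set T) B B' :
  S `<=` S' -> (B' <= B)%N -> covered E S' B' -> covered E S B.
Proof.
by move=> sS le [L [sL LP]]; exists L; split; [exact: leq_trans le | move=> x /sS/LP].
Qed.

Lemma covered_set0 (T : eqType) (E : T -> T -> Prop) B : covered E set0 B.
Proof. by exists [::]. Qed.

Lemma size_flatten_map (T T' : eqType) (g : T' -> seq T) (L : seq T') B :
  (forall l, size (g l) <= B)%N -> (size (flatten [seq g l | l <- L]) <= size L * B)%N.
Proof.
move=> gB; rewrite size_flatten /shape -map_comp.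
by elim: L => //= l L IH; rewrite mulSn leq_add.
Qed.

(** The fibres are those over the listed classes of [E'], not over exact values of [f]. *)
Lemma covered_fib (T T' : eqType) (f : T -> T') (E : T -> T -> Prop)
    (E' : T' -> T' -> Prop) (S : set T) (S' : set T') B B' :
  (forall x, S x -> S' (f x)) -> covered E' S' B' ->
  (forall l, covered E (S `&` [set x | E' (f x) l]) B) -> covered E S (B' * B).
Proof.
move=> fS [L [sL LP]] /choice[g gP]; exists (flatten [seq g l | l <- L]); split.
  apply: leq_trans (size_flatten_map _ (fun l => (gP l).1)) _.
  by rewrite leq_mul2r sL orbT.
move=> x Sx; have [l lL xl] := LP _ (fS _ Sx).
have [y yg xy] := (gP l).2 x (conj Sx xl); exists y => //.
by apply/flattenP; exists (g l) => //; apply: map_f.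
Qed.

Lemma covered_union (T : eqType) (I : finType) (E : T -> T -> Prop) (S : set T)
    (F : I -> set T) B :
  (forall x, S x -> exists i, F i x) -> (forall i, covered E (F i) B) ->
  covered E S (#|I| * B).
Proof.
move=> FS /choice[g gP]; exists (flatten [seq g i | i <- enum I]); split.
  by rewrite cardE; apply: size_flatten_map => i; case: (gP i).
move=> x /FS[i xi]; have [y yg xy] := (gP i).2 x xi; exists y => //.
by apply/flattenP; exists (g i) => //; apply: map_f; rewrite mem_enum.
Qed.

(** A class of [E'] met by [g] is represented by an element of [S] chosen above it. [x0] is only the
    default for listed classes that are not met. *)
Lemma covered_inj (T : choiceType) (T' : eqType) (g : T -> T') (E : T -> T -> Prop)
    (E' : T' -> T' -> Prop) (S : set T) (S' : set T') B :
  (forall x, S x -> S' (g x)) ->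
  (forall x y l, S x -> S y -> E' (g x) l -> E' (g y) l -> E x y) ->
  covered E' S' B -> covered E S B.
Proof.
move=> gS gE [L [sL LP]].
have [->|/set0P[x0 _]] := eqVneq S set0; first exact: covered_set0.
exists [seq xget x0 [set x | S x /\ E' (g x) l] | l <- L]; split; first by rewrite size_map.
move=> x Sx; have [l lL xl] := LP _ (gS _ Sx).
exists (xget x0 [set x | S x /\ E' (g x) l]); first exact: (map_f (fun l => xget x0 _)).
have [] : [set x | S x /\ E' (g x) l] (xget x0 [set x | S x /\ E' (g x) l]).
  by apply: xgetPex; exists x.
by move=> Sy yl; apply: (gE _ _ l).
Qed.

Variables (p : nat) (p_pr : prime p).
Local Notation Zp := (padic_int p_pr).
Local Notation Qp := (padic p_pr).
Let p_gt1 : (1 < p)%N := prime_gt1 p_pr.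

Definition pcongr (x y : Qp) := x - y \in pint.

Definition row_congr n (x y : 'rV[Qp]_n) := forall j, pcongr (x 0 j) (y 0 j).

Lemma pcongr_trans x y z : pcongr x z -> pcongr y z -> pcongr x y.
Proof. by move=> h h'; have := rpredB h h'; rewrite opprB addrA subrK. Qed.

Lemma covered_ball (S : set Qp) e :
  (forall x y, S x -> S y -> (pden (x - y)%R <= e)%N) -> covered pcongr S (p ^ e).
Proof.
move=> Se; have [->|/set0P[x0 Sx0]] := eqVneq S set0; first exact: covered_set0.
exists [seq x0 + i%:R / p%:R ^+ e | i <- iota 0 (p ^ e)]; split.
  by rewrite size_map size_iota.
move=> x Sx; have := Se _ _ Sx Sx0; rewrite -pdenP => /pintP[z zE].
have xE : x - x0 = tofrac z / p%:R ^+ e by rewrite -zE mulfK ?pX_neq0.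
exists (x0 + (z e)%:R / p%:R ^+ e).
  by apply/mapP; exists (z e); rewrite // mem_iota residue_lt.
by rewrite /pcongr opprD addrA xE pint_residueE.
Qed.

(** Coordinate 0 only has to be confined once the others are fixed modulo Z_p. The box count for the
    others is a hypothesis, so that the same step serves the induction in [covered_box] and later a
    row subject to a linear condition. *)
Lemma covered_row_step n (S : set 'rV[Qp]_n.+1) (e : 'I_n -> nat) e0
    (BE : covered (@row_congr n) [set x | forall j, (pden (x 0%R j) <= e j)%N]
           (p ^ \sum_j e j)) :
  (forall x j, S x -> (pden (x 0%R (lift ord0 j)) <= e j)%N) ->
  (forall x y, S x -> S y -> (forall j, pcongr (x 0 (lift ord0 j)) (y 0 (lift ord0 j))) ->
     (pden (x 0 ord0 - y 0 ord0)%R <= e0)%N) ->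
  covered (@row_congr n.+1) S (p ^ (e0 + \sum_j e j)).
Proof.
move=> Sl S0; rewrite expnD mulnC.
pose f (x : 'rV[Qp]_n.+1) : 'rV[Qp]_n := \row_j x 0 (lift ord0 j).
apply: (covered_fib (f := f) _ BE) => [x Sx j|l]; first by rewrite mxE Sl.
set F := S `&` _.
have FF x y j : F x -> F y -> pcongr (x 0 (lift ord0 j)) (y 0 (lift ord0 j)).
  by move=> [_ xl] [_ yl]; have := pcongr_trans (xl j) (yl j); rewrite !mxE.
apply: (@covered_inj _ _ (fun x : 'rV[Qp]_n.+1 => x 0 ord0) _ pcongr _
  [set x 0 ord0 | x in F]) => [x Fx|x y z Fx Fy xz yz j|]; first by exists x.
  case: (unliftP ord0 j) => [j' ->|->]; first exact: FF.
  exact: pcongr_trans xz yz.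
apply: covered_ball => _ _ [x Fx <-] [y Fy <-]; apply: S0; [by case: Fx|by case: Fy|].
by move=> j; exact: FF.
Qed.

Lemma covered_box n (e : 'I_n -> nat) :
  covered (@row_congr n) [set x | forall j, (pden (x 0%R j) <= e j)%N] (p ^ \sum_j e j).
Proof.
elim: n e => [|n IH] e.
  by exists [:: 0]; split=> [|x _]; rewrite ?big_ord0 //; exists 0; rewrite ?inE // => -[].
rewrite big_ord_recl; apply: covered_row_step (IH _) _ _ => [x j|x y xe ye _]; first exact.
rewrite -pdenP mulrBl rpredB // pdenP; [exact: xe | exact: ye].
Qed.

End Covered.

(** * Unipotent matrices and minors *)

Section Unipotent.
Variable A : comUnitRingType.
Implicit Types (m : nat).

Lemma unip_blockP m (u : 'M[A]_(1 + m)) : unip u ->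
  [/\ u = block_mx 1%:M (ursubmx u) 0 (drsubmx u) & unip (drsubmx u)].
Proof.
move=> [u1 u0]; split; last first.
  split=> [i|i j ij]; first by rewrite !mxE u1.
  by rewrite !mxE u0 //= /bump !leq0n !add1n.
rewrite -[LHS]submxK; congr block_mx; apply/matrixP => i j.
  by rewrite !ord1 !mxE -[RHS](u1 (lshift m ord0)); congr (u _ _); apply: val_inj.
by rewrite !mxE u0 // /= ord1.
Qed.

Lemma unip_block m (x : 'rV[A]_m) (u : 'M[A]_m) : unip u ->
  unip (block_mx (1%:M : 'M[A]_1) x 0 u).
Proof.
move=> [u1 u0]; split=> [i|i j ij].
  case: (splitP i) => k ik.
    have -> : i = lshift m k by apply: val_inj.
    by rewrite block_mxEul mxE ord1.
  have -> : i = rshift 1 k by apply: val_inj.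
  by rewrite block_mxEdr u1.
case: (splitP i) => k ik; first by move: ij; rewrite ik (ord1 k).
have -> : i = rshift 1 k by apply: val_inj.
case: (splitP j) => l jl.
  have -> : j = lshift m l by apply: val_inj.
  by rewrite block_mxEdl mxE.
have -> : j = rshift 1 l by apply: val_inj.
by rewrite block_mxEdr u0 //; move: ij; rewrite ik jl /=; lia.
Qed.

Lemma unip1 m : unip (1%:M : 'M[A]_m).
Proof.
split=> [i|i j ij]; rewrite mxE ?eqxx //.
by case: eqP ij => // ->; rewrite ltnn.
Qed.

Lemma unipM m (u v : 'M[A]_m) : unip u -> unip v -> unip (u *m v).
Proof.
move=> [u1 u0] [v1 v0]; split=> [i|i j ij]; rewrite mxE.
  rewrite (bigD1 i) //= u1 v1 mulr1 big1 ?addr0 // => k ki.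
  have [lt|lt|/val_inj e] := ltngtP k i; last by rewrite e eqxx in ki.
    by rewrite u0 ?mul0r.
  by rewrite v0 ?mulr0.
rewrite big1 // => k _; have [lt|ge] := ltnP k i; first by rewrite u0 ?mul0r.
by rewrite v0 ?mulr0 //; apply: leq_trans ge.
Qed.

Lemma unip_ex_inv m (u : 'M[A]_m) : unip u -> exists2 v, unip v & v *m u = 1%:M.
Proof.
elim: m u => [|m IH] u uu; first by exists u; rewrite // [LHS]flatmx0 [RHS]flatmx0.
have [uE /IH[v vu vE]] := @unip_blockP m u uu.
move: uE vE; set x := ursubmx _; set w := drsubmx _ => uE vE.
exists (block_mx (1%:M : 'M[A]_1) (- x *m v) 0 v); first exact: unip_block.
rewrite uE; apply: etrans (mulmx_block 1%:M (- x *m v) 0 v 1%:M x 0 w) _.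
rewrite !mul1mx !mulmx0 !mul0mx addr0 !add0r -mulmxA vE mulmx1.
by rewrite addrC addNr -scalar_mx_block.
Qed.

Lemma unip_unitmx m (u : 'M[A]_m) : unip u -> u \in unitmx.
Proof. by move=> /unip_ex_inv[v _ /mulmx1_unit[]]. Qed.

Lemma unip_invmx m (u : 'M[A]_m) : unip u -> unip (invmx u).
Proof.
move=> uu; have [v vu vE] := unip_ex_inv uu; have ut := unip_unitmx uu.
by have <- : v = invmx u by rewrite -[v]mulmx1 -(mulmxV ut) mulmxA vE mul1mx.
Qed.

(** No index lies strictly between j and j + 1, so the superdiagonal is a homomorphism from U to an
    additive group. *)
Lemma unip_mulr_superdiag m (u v : 'M[A]_m.+1) (j : 'I_m) : unip u -> unip v ->
  (u *m v) (widen_ord (leqnSn m) j) (lift ord0 j) =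
  u (widen_ord (leqnSn m) j) (lift ord0 j) + v (widen_ord (leqnSn m) j) (lift ord0 j).
Proof.
set a := widen_ord _ j; set b := lift ord0 j.
have ba : b != a by rewrite -val_eqE /= /bump /= add1n; apply/eqP; lia.
move=> [u1 u0] [v1 v0]; rewrite mxE (bigD1 a) //= (bigD1 b) //= big1 ?addr0.
  by rewrite u1 v1 mul1r mulr1 addrC.
move=> k /andP[ka kb]; have [lt|ge] := ltnP k a; first by rewrite u0 ?mul0r.
rewrite v0 ?mulr0 //; move: ka kb ge; rewrite -!val_eqE /= /bump /=; lia.
Qed.

End Unipotent.

Lemma unip_map (A B : comUnitRingType) (f : {rmorphism A -> B}) m (u : 'M[A]_m) :
  unip u -> unip (map_mx f u).
Proof.
by move=> [u1 u0]; split=> [i|i j ij]; rewrite mxE ?u1 ?rmorph1 ?u0 ?rmorph0.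
Qed.

Section Minors.
Variable A : comNzRingType.

(** The first k + 1 rows of a lower triangular matrix vanish beyond column k, so the Cauchy-Binet
    sum has a single term. *)
Lemma mxsub_lower m k (lek : (k < m)%N) (b K : 'M[A]_m) (g : 'I_k.+1 -> 'I_m) :
  is_trig_mx b ->
  \det (mxsub (widen_ord lek) g (b *m K)) =
  (\prod_(j < m | (j <= k)%N) b j j) * \det (mxsub (widen_ord lek) g K).
Proof.
move=> /is_trig_mxP bt.
have -> : mxsub (widen_ord lek) g (b *m K) =
    mxsub (widen_ord lek) (widen_ord lek) b *m mxsub (widen_ord lek) g K.
  apply/matrixP => i j; rewrite !mxE.
  rewrite [LHS](bigID (fun l : 'I_m => (l < k.+1)%N)) /= [X in _ + X]big1 ?addr0.
    by rewrite (big_ord_narrow (F := fun l => b (widen_ord lek i) l * K l (g j)) lek);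
       apply: eq_bigr => l _; rewrite !mxE.
  by move=> l; rewrite -leqNgt => kl; rewrite bt ?mul0r // (leq_trans _ kl) /= ?ltn_ord.
rewrite det_mulmx det_trig; last first.
  by apply/is_trig_mxP => i j ij; rewrite mxE bt.
by rewrite (big_ord_narrow (F := fun j => b j j) lek); congr (_ * _);
   apply: eq_bigr => j _; rewrite mxE.
Qed.

Lemma det_unip_lead m k (lek : (k < m)%N) (u : 'M[A]_m) : unip u ->
  \det (mxsub (widen_ord lek) (widen_ord lek) u) = 1.
Proof.
move=> [u1 u0]; rewrite -det_tr det_trig; last first.
  by apply/is_trig_mxP => i j ij; rewrite !mxE u0.
by rewrite big1 // => i _; rewrite !mxE u1.
Qed.

Variables (m : nat) (b : 'M[A]_m.+1) (M : 'M[A]_m.+2).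
Hypothesis b_trig : is_trig_mx b.
Hypothesis M00 : M ord0 ord0 = 1.
Hypothesis Ml0 : forall i, M (lift ord0 i) ord0 = 0.
Hypothesis Mll : forall i j, M (lift ord0 i) (lift ord0 j) = b i j.

Let minor_b k (lek : (k < m.+1)%N) :
  \det (mxsub (widen_ord lek) (widen_ord lek) b) = \prod_(j < m.+1 | (j <= k)%N) b j j.
Proof.
rewrite -[b in LHS]mulmx1 mxsub_lower // det_unip_lead ?mulr1 //.
by split=> [i|i j ij]; rewrite mxE ?eqxx //; case: eqP ij => // ->; rewrite ltnn.
Qed.

Lemma minor_corner k (lek : (k.+1 < m.+2)%N) :
  \det (mxsub (widen_ord lek) (widen_ord lek) M) = \prod_(j < m.+1 | (j <= k)%N) b j j.
Proof.
have lek' : (k < m.+1)%N by [].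
have w0 : widen_ord lek ord0 = ord0 by apply: val_inj.
have wl i : widen_ord lek (lift ord0 i) = lift ord0 (widen_ord lek' i) by apply: val_inj.
rewrite (expand_det_col _ ord0) big_ord_recl big1 ?addr0.
  rewrite mxE w0 M00 mul1r /cofactor /= expr0 mul1r -(minor_b lek').
  by congr (\det _); apply/matrixP => i j; rewrite !mxE !wl Mll.
by move=> i _; rewrite mxE wl w0 Ml0 mul0r.
Qed.

(** In the last chosen column the rows coming from [b] lie above its diagonal. Expanding along that
    column isolates one entry of the border row, times a leading minor of [b]. *)
Lemma minor_shift k (lek : (k.+1 < m.+2)%N) (lek1 : (k.+1 < m.+1)%N) :
  \det (mxsub (widen_ord lek) (fun j => lift ord0 (widen_ord lek1 j)) M) =
  (-1) ^+ k.+1 * M ord0 (lift ord0 (Ordinal lek1)) * \prod_(j < m.+1 | (j <= k)%N) b j j.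
Proof.
have lek' : (k < m.+1)%N by [].
have w0 : widen_ord lek ord0 = ord0 by apply: val_inj.
have wl i : widen_ord lek (lift ord0 i) = lift ord0 (widen_ord lek' i) by apply: val_inj.
have wm : widen_ord lek1 ord_max = Ordinal lek1 by apply: val_inj.
rewrite (expand_det_col _ ord_max) big_ord_recl big1 ?addr0.
  rewrite mxE w0 wm /cofactor /= mulrA [M _ _ * _]mulrC -(minor_b lek').
  congr (_ * _ * \det _); apply/matrixP => i j; rewrite !mxE wl Mll; congr (b _ _).
  by apply: val_inj; rewrite /= /bump leqNgt ltn_ord.
move=> i _; rewrite mxE wl wm Mll; move/is_trig_mxP: b_trig => -> //; first by rewrite mul0r.
by rewrite /= ltn_ord.
Qed.

End Minors.

Section BlockEntries.
Variables (A : nzRingType) (m : nat) (x : 'rV[A]_m.+1) (b : 'M[A]_m.+1).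
Let M : 'M[A]_m.+2 := block_mx (1%:M : 'M[A]_1) x 0 b.

Let l0 : @lshift 1 m.+1 ord0 = ord0 :> 'I_m.+2. Proof. exact: val_inj. Qed.
Let rl (i : 'I_m.+1) : @rshift 1 m.+1 i = lift ord0 i :> 'I_m.+2.
Proof. exact: val_inj. Qed.

Lemma border00 : M ord0 ord0 = 1.
Proof. by rewrite -l0; apply: etrans (block_mxEul _ _ _ _ _ _) _; rewrite mxE. Qed.

Lemma borderl0 i : M (lift ord0 i) ord0 = 0.
Proof. by rewrite -rl -l0; apply: etrans (block_mxEdl _ _ _ _ _ _) _; rewrite mxE. Qed.

Lemma border0l j : M ord0 (lift ord0 j) = x 0 j.
Proof.
rewrite -rl -l0; apply: etrans (block_mxEur _ _ _ _ _ _) _.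
by congr (x _ _); apply: val_inj.
Qed.

Lemma borderll i j : M (lift ord0 i) (lift ord0 j) = b i j.
Proof. by rewrite -!rl; apply: etrans (block_mxEdr _ _ _ _ _ _) _. Qed.

End BlockEntries.

(** * Iwasawa decomposition over Q_p *)

Lemma block_clear_row (A : nzRingType) m (a : 'M[A]_1) (z : 'rV[A]_m) (c : 'cV[A]_m)
    (d : 'M[A]_m) :
  block_mx a (a *m z) c d *m block_mx 1%:M (- z) 0 1%:M = block_mx a 0 c (d - c *m z).
Proof.
by rewrite mulmx_block !mulmx1 !mulmx0 !addr0 !mulmxN addNr [- _ + d]addrC.
Qed.

Lemma mulmx_block_diag1 (A : nzRingType) m (a : 'M[A]_1) (z : 'rV[A]_m) (c : 'cV[A]_m)
    (d k : 'M[A]_m) :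
  block_mx a z c d *m block_mx 1%:M 0 0 k = block_mx a (z *m k) c (d *m k).
Proof. by rewrite mulmx_block !mulmx1 !mulmx0 !addr0 !add0r. Qed.

Lemma map_unitmx_ring (A B : comUnitRingType) (f : {rmorphism A -> B}) m (k : 'M[A]_m) :
  k \in unitmx -> map_mx f k \in unitmx.
Proof. by rewrite !unitmxE det_map_mx => /(rmorph_unit f). Qed.

Section Iwasawa.
Variables (p : nat) (p_pr : prime p).
Local Notation Zp := (padic_int p_pr).
Local Notation Qp := (padic p_pr).
Local Notation "k ^F" := (map_mx (@tofrac Zp) k) (at level 2, format "k ^F").
Let p_gt1 : (1 < p)%N := prime_gt1 p_pr.

Lemma dominant_entry m (f : 'I_m.+1 -> Qp) :
  exists j0, forall j, exists2 z, z \in pint & f j = f j0 * z.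
Proof.
elim: m f => [|m IH] f.
  by exists ord0 => j; exists 1; rewrite ?rpred1 // mulr1 (ord1 j).
have [j0 j0P] := IH (fun j => f (lift ord0 j)).
have [[z zi e]|[z zi e]] := pint_total (f ord0) (f (lift ord0 j0)).
  exists (lift ord0 j0) => j; case: (unliftP ord0 j) => [j' ->|->]; first exact: j0P.
  by exists z.
exists ord0 => j; case: (unliftP ord0 j) => [j' ->|->].
  by have [z' z'i ->] := j0P j'; exists (z * z'); rewrite ?rpredM // mulrA -e.
by exists 1; rewrite ?rpred1 // mulr1.
Qed.

(** Column elimination over Z_p: a permutation moves an entry of largest absolute value of the first
    row into the corner, the rest of that row consists of integral multiples of it and is cleared,
    and the lower right block is treated by induction. *)
Lemma iwasawa m (g : 'M[Qp]_m) : g \in unitmx ->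
  exists2 k : 'M[Zp]_m, k \in unitmx & is_trig_mx (g *m k^F).
Proof.
elim: m g => [|m IH] g gu.
  by exists 1%:M; rewrite ?unitmx1 //; apply/is_trig_mxP => -[].
have [j0 j0P] := dominant_entry (g ord0).
have a0 : g ord0 j0 != 0.
  apply/eqP => a0; move: gu; rewrite unitmxE (expand_det_row _ ord0) big1 ?unitr0 //.
  by move=> j _; have [z _ ->] := j0P j; rewrite a0 !mul0r.
pose P : 'M[Zp]_m.+1 := tperm_mx ord0 j0.
pose g1 : 'M[Qp]_m.+1 := g *m P^F.
have g1E j : exists j', g1 ord0 j = g ord0 j'.
  by rewrite /g1 /P map_tperm_mx -xcolE mxE; eexists.
have g10 : g1 ord0 ord0 = g ord0 j0.
  by rewrite /g1 /P map_tperm_mx -xcolE mxE perm.tpermL.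
have /choice[zf zfE] : forall j : 'I_m, exists z : Zp,
    g1 ord0 (lift ord0 j) = g ord0 j0 * tofrac z.
  move=> j; have [j' ->] := g1E (lift ord0 j).
  by have [_ /pintP[z ->] ->] := j0P j'; exists z.
have g1u : g1 \in unitmx by rewrite unitmx_mul gu map_tperm_mx unitmx_perm.
have gE : g *m P^F = g1 by [].
clearbody g1; clear g1E.
pose z : 'rV[Zp]_m := \row_j zf j.
pose a : 'M[Qp]_1 := (g ord0 j0)%:M.
pose c : 'cV[Qp]_m := @dlsubmx _ 1 m 1 m g1.
pose d : 'M[Qp]_m := @drsubmx _ 1 m 1 m g1.
have g1B : g1 = block_mx a (a *m z^F) c d.
  have aE : @ulsubmx _ 1 m 1 m g1 = a.
    by apply/matrixP => i j; rewrite !ord1 !mxE eqxx -g10; congr (g1 _ _); apply: val_inj.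
  have zE : @ursubmx _ 1 m 1 m g1 = a *m z^F.
    apply/matrixP => i j; rewrite ord1 mul_scalar_mx !mxE -zfE.
    by congr (g1 _ _); apply: val_inj.
  by apply: etrans (esym (@submxK _ 1 m 1 m g1)) _; rewrite aE zE.
pose k1 : 'M[Zp]_m.+1 := block_mx (1%:M : 'M[Zp]_1) (- z) 0 1%:M.
have k1u : k1 \in unitmx.
  rewrite unitmxE; have -> : \det k1 = 1; last exact: unitr1.
  by apply: etrans (@det_ublock _ 1 m 1%:M (- z) 1%:M) _; rewrite !det1 mulr1.
have k1F : k1^F = block_mx (1%:M : 'M[Qp]_1) (- z^F) 0 1%:M.
  have := map_block_mx (@tofrac Zp) (1%:M : 'M[Zp]_1) (- z) 0 (1%:M : 'M[Zp]_m).
  by rewrite !map_mx1 map_mxN map_mx0.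
pose g' := d - c *m z^F.
have e : g1 *m k1^F = block_mx a 0 c g'.
  by rewrite k1F g1B; exact: block_clear_row.
have g'u : g' \in unitmx.
  have : g1 *m k1^F \in unitmx by rewrite unitmx_mul g1u map_unitmx_ring.
  rewrite e unitmxE; have -> : \det (block_mx a 0 c g' : 'M[Qp]_m.+1) = \det a * \det g'.
    exact: (@det_lblock _ 1 m a c g').
  by rewrite unitrM => /andP[_ h]; rewrite unitmxE.
have [k2 k2u k2t] := IH _ g'u.
pose k3 : 'M[Zp]_m.+1 := block_mx (1%:M : 'M[Zp]_1) 0 0 k2.
have k3u : k3 \in unitmx.
  rewrite unitmxE; have -> : \det k3 = \det k2.
    by apply: etrans (@det_ublock _ 1 m 1%:M 0 k2) _; rewrite det1 mul1r.
  by rewrite -unitmxE.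
exists (P *m k1 *m k3); first by rewrite !unitmx_mul unitmx_perm k1u.
have k3F : k3^F = block_mx (1%:M : 'M[Qp]_1) 0 0 k2^F.
  have := map_block_mx (@tofrac Zp) (1%:M : 'M[Zp]_1) 0 0 k2.
  by rewrite !map_mx1 !map_mx0.
rewrite !map_mxM !mulmxA gE e k3F.
have -> : block_mx a 0 c g' *m block_mx (1%:M : 'M[Qp]_1) 0 0 k2^F =
    block_mx a 0 c (g' *m k2^F) :> 'M[Qp]_m.+1.
  by rewrite -[in RHS](mul0mx _ k2^F); exact: mulmx_block_diag1.
apply: etrans (@is_trig_block_mx _ 1 m 1 m a 0 c (g' *m k2^F) erefl) _.
by rewrite eqxx k2t mx11_is_trig.
Qed.

End Iwasawa.

(** * Counting unipotent matrices *)

Lemma mulf_div_cancel (F : fieldType) (e y u a b : F) : a != 0 ->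
  e * y * (u / a) * (b * a) = y * b * (e * u).
Proof. by move=> a0; field. Qed.

Section Count.
Variables (p : nat) (p_pr : prime p).
Local Notation Zp := (padic_int p_pr).
Local Notation Qp := (padic p_pr).
Local Notation "k ^F" := (map_mx (@tofrac Zp) k) (at level 2, format "k ^F").
Let p_gt1 : (1 < p)%N := prime_gt1 p_pr.

(* r i is the exponent of the largest absolute value of a minor on the first i + 1
   rows of v. *)
Definition iwa m (v : 'M[Qp]_m.+1) (k : 'M[Zp]_m.+1) (r : nat -> nat) :=
  [/\ k \in unitmx, is_trig_mx (v *m k^F)
    & forall i : 'I_m.+1,
      (\prod_(j < m.+1 | (j <= i)%N) (v *m k^F) j j) * p%:R ^+ r i \in punit].

(** The cofactor [z] is a minor of the integral matrix [K]. *)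
Lemma minor_factor m k (lek : (k < m)%N) (b : 'M[Qp]_m) (K : 'M[Zp]_m)
    (g : 'I_k.+1 -> 'I_m) : is_trig_mx b ->
  exists2 z, z \in pint &
    \det (mxsub (widen_ord lek) g (b *m K^F)) = (\prod_(j < m | (j <= k)%N) b j j) * z.
Proof.
move=> bt; rewrite mxsub_lower //; eexists; last by [].
by rewrite -map_mxsub det_map_mx pint_tofrac.
Qed.

Lemma mapKmx m n (k : 'M[Zp]_m) (v : 'M[Qp]_(n, m)) : k \in unitmx ->
  v *m k^F *m (invmx k)^F = v.
Proof. by move=> ku; rewrite -mulmxA -map_mxM mulmxV // map_mx1 mulmx1. Qed.

(** The leading minors of [v] equal 1, and each is a p-adic integer times the corresponding diagonal
    product. That product thus has absolute value at least 1, and natural exponents suffice for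
    [r]. *)
Lemma unip_iwa m (v : 'M[Qp]_m.+1) : unip v -> exists k r, iwa v k r.
Proof.
move=> uv; have [k ku kt] := iwasawa (unip_unitmx uv).
have /choice[f fP] : forall i : 'I_m.+1, exists e : nat,
    (\prod_(j < m.+1 | (j <= i)%N) (v *m k^F) j j) * p%:R ^+ e \in punit.
  move=> i; have [z /pintP[z' ->]] := minor_factor (ltn_ord i) (invmx k) (widen_ord (ltn_ord i)) kt.
  rewrite mapKmx // det_unip_lead //; set P := \prod_(j < _ | _) _ => e.
  have z0 : z' != 0.
    by apply/eqP => z0; move/eqP: e; rewrite z0 tofrac0 mulr0 oner_eq0.
  have [d [u uu zE]] := tofrac_decomp z0; exists d.
  have -> : P * p%:R ^+ d = u^-1; last exact: punitV.
  by apply: (mulIf (punit_neq0 uu)); rewrite mulVf ?(punit_neq0 uu) // -mulrA -zE -e.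
by exists k; exists (fun i => f (inord i)); split => // i; rewrite inord_val.
Qed.

Section Border.
Variables (m : nat) (v : 'M[Qp]_m.+2) (k : 'M[Zp]_m.+2) (r : nat -> nat)
  (x : 'rV[Qp]_m.+1) (w : 'M[Qp]_m.+1) (k1 : 'M[Zp]_m.+1) (rho : nat -> nat).
Hypothesis v_block : v = block_mx (1%:M : 'M[Qp]_1) x 0 w.
Hypothesis v_iwa : iwa v k r.
Hypothesis w_iwa : iwa w k1 rho.
Let xx := x *m k1^F.
Let b1 := w *m k1^F.
Let M : 'M[Qp]_m.+2 := block_mx (1%:M : 'M[Qp]_1) xx 0 b1.

Let b1_trig : is_trig_mx b1. Proof. by case: w_iwa. Qed.

(** [M] is [v] times diag(1, k1), so it differs from the triangular matrix [v *m k^F] by an integral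
    factor. Hence [r] bounds the minors of [M] on its first rows, and these are explicit in [xx] and
    [b1]. *)
Let M_factor : exists K : 'M[Zp]_m.+2, M = (v *m k^F) *m K^F.
Proof.
case: v_iwa => ku _ _.
pose k2 : 'M[Zp]_m.+2 := block_mx (1%:M : 'M[Zp]_1) 0 0 k1.
exists (invmx k *m k2); rewrite map_mxM mulmxA mapKmx //.
have k2F : k2^F = block_mx (1%:M : 'M[Qp]_1) 0 0 k1^F.
  have := map_block_mx (@tofrac Zp) (1%:M : 'M[Zp]_1) 0 0 k1.
  by rewrite !map_mx1 !map_mx0.
rewrite k2F v_block; symmetry; exact: mulmx_block_diag1.
Qed.

Let minor_int i (lei : (i < m.+2)%N) g :
  \det (mxsub (widen_ord lei) g M) * p%:R ^+ r i \in pint.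
Proof.
case: v_iwa => _ kt kP; have [K ->] := M_factor.
have [z zi ->] := minor_factor lei K g kt.
by rewrite mulrAC rpredM // punit_int // (kP (Ordinal lei)).
Qed.

Let M00 := border00 xx b1.
Let Ml0 := borderl0 xx b1.
Let M0l := border0l xx b1.
Let Mll := borderll xx b1.

Lemma border_den0 j : (pden (xx 0%R j) <= r 0)%N.
Proof.
have := @minor_int 0 isT (fun=> lift ord0 j); rewrite -pdenP.
rewrite {1}[mxsub _ _ _]mx11_scalar det_scalar1 mxE -M0l.
by congr (M _ _ * _ \in pint); apply: val_inj.
Qed.

Let iwa_prod i (lei : (i < m.+1)%N) : exists2 u, u \in punit &
  \prod_(j < m.+1 | (j <= i)%N) b1 j j = u / p%:R ^+ rho i.
Proof.
case: w_iwa => _ _ h; eexists; first exact: (h (Ordinal lei)).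
by rewrite mulfK ?pX_neq0.
Qed.

(** A leading minor of [M] is a diagonal product of [b1], of absolute value p^(rho i), and it is
    also a minor on the first i + 2 rows. *)
Lemma border_le (i : 'I_m.+1) : (rho i <= r i.+1)%N.
Proof.
have lei : (i.+1 < m.+2)%N by rewrite ltnS ltn_ord.
have := minor_int lei (widen_ord lei); rewrite (minor_corner b1_trig M00 Ml0 Mll).
have [u uu ->] := iwa_prod (ltn_ord i) => h; rewrite leqNgt; apply/negP => lt.
have := h; rewrite mulrC mulrCA -[_ * (_ / _)]mulrC pint_mulr_unit //.
rewrite -[in X in _ ^- X](subnK (ltnW lt)) exprD invfM mulrCA mulfV ?pX_neq0 // mulr1.
by rewrite pint_pXV subn_eq0 leqNgt lt.
Qed.

(** A shifted minor is, up to sign, the entry times a diagonal product of [b1]. The former is at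
    most p^(r (i + 1)), the latter is exactly p^(rho i). *)
Lemma border_denS (i : 'I_m) : (pden (xx 0%R (lift ord0 i)) <= r i.+1 - rho i)%N.
Proof.
have lei1 : (i.+1 < m.+1)%N by rewrite ltnS ltn_ord.
have lei : (i.+1 < m.+2)%N by apply: ltnW.
have lei' : (i < m.+1)%N by apply: ltnW.
have := minor_int lei (fun j => lift ord0 (widen_ord lei1 j)).
rewrite (minor_shift b1_trig Mll); have [u uu ->] := iwa_prod lei'.
have -> : lift ord0 (Ordinal lei1) = lift ord0 (lift ord0 i) by apply: val_inj.
rewrite (M0l (lift ord0 i)) -pdenP => h.
have le := border_le (Ordinal lei').
rewrite -(pint_mulr_unit _ (punitM (punit_sign p_pr i.+1) uu)).
by rewrite -(mulf_div_cancel _ _ _ _ (pX_neq0 p_pr (rho i))) -exprD subnK.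
Qed.

End Border.
End Count.

Lemma mulmx_border (A : nzRingType) m (x y : 'rV[A]_m) (a b : 'M[A]_m) :
  block_mx 1%:M x 0 a *m block_mx 1%:M y 0 b =
  block_mx (1%:M : 'M[A]_1) (y + x *m b) 0 (a *m b).
Proof. by rewrite mulmx_block !mul1mx !mulmx0 !mul0mx !addr0 !add0r. Qed.

Lemma mulf_swap4 (F : fieldType) (y d a e f : F) :
  y * (d * a) * (e * f) = d * f * (y * a * e).
Proof. by ring. Qed.

Lemma dot_diff_recl (A : nzRingType) m (y y' c : 'I_m.+1 -> A) :
  (y ord0 - y' ord0) * c ord0 = \sum_j y j * c j - \sum_j y' j * c j -
    \sum_(i < m) (y (lift ord0 i) - y' (lift ord0 i)) * c (lift ord0 i).
Proof.
rewrite -sumrB (eq_bigr (fun j => (y j - y' j) * c j)); last first.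
  by move=> j _; rewrite mulrBl.
by rewrite big_ord_recl addrK.
Qed.

Section Fibre.
Local Open Scope classical_set_scope.
Variables (p : nat) (p_pr : prime p).
Local Notation Zp := (padic_int p_pr).
Local Notation Qp := (padic p_pr).
Local Notation "k ^F" := (map_mx (@tofrac Zp) k) (at level 2, format "k ^F").
Let p_gt1 : (1 < p)%N := prime_gt1 p_pr.

Definition unip_congr m (v w : 'M[Qp]_m) :=
  exists2 h : 'M[Zp]_m, unip h & v = w *m h^F.

Variables (m : nat) (w : 'M[Qp]_m.+1) (k1 : 'M[Zp]_m.+1) (r rho : nat -> nat).
Hypothesis w_unip : unip w.
Hypothesis w_iwa : iwa w k1 rho.
Variable S : set 'M[Qp]_m.+2.
Hypothesis S_P : forall v, S v -> exists (x : 'rV[Qp]_m.+1) (h : 'M[Zp]_m.+1) k,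
  [/\ unip h, iwa v k r & v = block_mx (1%:M : 'M[Qp]_1) x 0 (w *m h^F)].

(** For a border [x] and a block [w *m h^F] this is x h^-1 k1: the border in the coordinates where
    its minors are bounded. Inverting the block makes it a function of [v] alone, without a choice
    of [h]. *)
Let g (v : 'M[Qp]_m.+2) : 'rV[Qp]_m.+1 :=
  @ursubmx _ 1 m.+1 1 m.+1 v *m invmx (@drsubmx _ 1 m.+1 1 m.+1 v) *m (w *m k1^F).

Let k1_unit : k1 \in unitmx. Proof. by case: w_iwa. Qed.

Let gE x (h : 'M[Zp]_m.+1) : unip h ->
  g (block_mx (1%:M : 'M[Qp]_1) x 0 (w *m h^F)) = x *m (invmx h *m k1)^F.
Proof.
move=> uh; have hu := unip_unitmx uh.
rewrite /g block_mxKur block_mxKdr -mulmxA; congr (_ *m _).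
have whu : w *m h^F \in unitmx by rewrite unitmx_mul unip_unitmx ?map_unitmx_ring.
rewrite -[RHS](mulKmx whu); congr (_ *m _).
by rewrite map_mxM !mulmxA mapKmx.
Qed.

Let gK x (h : 'M[Zp]_m.+1) : unip h ->
  x = g (block_mx (1%:M : 'M[Qp]_1) x 0 (w *m h^F)) *m (invmx k1 *m h)^F.
Proof.
move=> uh; have hu := unip_unitmx uh; rewrite gE // -mulmxA -map_mxM.
by rewrite -mulmxA (mulmxA k1) mulmxV // mul1mx mulVmx // map_mx1 mulmx1.
Qed.

Let iwaJ (h : 'M[Zp]_m.+1) : unip h -> iwa (w *m h^F) (invmx h *m k1) rho.
Proof.
move=> uh; have hu := unip_unitmx uh.
have e : w *m h^F *m (invmx h *m k1)^F = w *m k1^F.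
  by rewrite map_mxM !mulmxA mapKmx.
by case: w_iwa => k1u kt kP; split; rewrite ?e // unitmx_mul unitmx_inv hu.
Qed.

(** Integral changes of [g v] are exactly absorbed by the first row of a matrix in U(Z_p), so [g]
    separates the classes of [S] and it suffices to count rows. *)
Lemma fibre_covered (T : set 'rV[Qp]_m.+1) B :
  (forall v, S v -> T (g v)) -> covered (@row_congr p p_pr m.+1) T B ->
  covered (@unip_congr m.+2) S B.
Proof.
move=> gT; apply: (covered_inj gT) => v v' l Sv Sv' vl v'l.
have [x [h [k [uh _ vE]]]] := S_P Sv; have [x' [h' [k' [uh' _ vE']]]] := S_P Sv'.
have /choice[z zE] : forall j, exists z, g v 0 j - g v' 0 j = tofrac z.
  by move=> j; apply/pintP; exact: pcongr_trans (vl j) (v'l j).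
have {}zE : g v = (\row_j z j)^F + g v'.
  by move: (g v) (g v') zE => y y' yz; apply/rowP => j; rewrite !mxE -yz subrK.
have hu' := unip_unitmx uh'.
exists (block_mx (1%:M : 'M[Zp]_1) (\row_j z j *m (invmx k1 *m h)) 0 (invmx h' *m h)).
  by apply: unip_block; apply: unipM => //; exact: unip_invmx.
have -> : forall y (a : 'M[Zp]_m.+1), (block_mx (1%:M : 'M[Zp]_1) y 0 a)^F =
    block_mx (1%:M : 'M[Qp]_1) y^F 0 a^F.
  move=> y a; have := map_block_mx (@tofrac Zp) (1%:M : 'M[Zp]_1) y 0 a.
  by rewrite !map_mx1 !map_mx0.
have xE := gK x uh; have xE' := gK x' uh'; rewrite -vE in xE; rewrite -vE' in xE'.
rewrite [in LHS]vE vE'; symmetry; apply: etrans (mulmx_border _ _ _ _) _.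
move: (g v) (g v') zE xE xE' => y y' zE xE xE'.
have e : (invmx k1 *m h') *m (invmx h' *m h) = invmx k1 *m h.
  by rewrite -mulmxA mulKVmx.
have xE'' : x' *m (invmx h' *m h)^F = y' *m (invmx k1 *m h)^F.
  by rewrite xE' -mulmxA -map_mxM e.
have wE : w *m h'^F *m (invmx h' *m h)^F = w *m h^F.
  by rewrite -mulmxA -map_mxM mulKVmx.
by rewrite xE'' (map_mxM _ (\row_j z j)) -mulmxDl -zE -xE wE.
Qed.

Let g_den0 v : S v -> forall j, (pden (g v 0%R j) <= r 0)%N.
Proof.
move=> Sv j; have [x [h [k [uh vk vE]]]] := S_P Sv.
by rewrite vE gE //; exact: (border_den0 _ vE vk).
Qed.

Let g_denS v : S v -> forall i : 'I_m, (pden (g v 0%R (lift ord0 i)) <= r i.+1 - rho i)%N.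
Proof.
move=> Sv i; have [x [h [k [uh vk vE]]]] := S_P Sv.
by rewrite vE gE //; apply: border_denS vE vk (iwaJ uh) i.
Qed.

Lemma fibre_covered_box :
  covered (@unip_congr m.+2) S (p ^ (r 0 + \sum_(i < m) (r i.+1 - rho i))).
Proof.
pose e (j : 'I_m.+1) := if unlift ord0 j is Some i then (r i.+1 - rho i)%N else r 0.
have -> : (r 0 + \sum_(i < m) (r i.+1 - rho i))%N = (\sum_j e j)%N.
  rewrite big_ord_recl /e unlift_none; congr addn.
  by apply: eq_bigr => i _; rewrite liftK.
apply: fibre_covered (covered_box p_pr e) => v Sv j.
rewrite /e; case: unliftP => [i ->|_]; [exact: g_denS | exact: g_den0].
Qed.

(** All coordinates are 1 by 1 minors, hence at most p^(r 0). This is useful when [r 0] is small. *)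
Lemma fibre_covered_cube : covered (@unip_congr m.+2) S (p ^ (m.+1 * r 0)).
Proof.
have -> : (m.+1 * r 0)%N = (\sum_(j < m.+1) r 0)%N by rewrite sum_nat_const card_ord.
apply: fibre_covered (covered_box p_pr _) => v Sv j; exact: g_den0.
Qed.

(** The entry (0, 1) of [v] is the combination of the coordinates of [g v] with coefficients the
    first column of k1^-1, and the coefficient of coordinate 0 has absolute value p^(- rho 0). With
    the other coordinates fixed modulo Z_p, bounding that entry by p^s leaves p^(s + rho 0) choices
    for coordinate 0 instead of p^(r 0). *)
Lemma fibre_covered_superdiag s :
  (forall v, S v -> (pden (v ord0 (lift ord0 ord0)) <= s)%N) ->
  covered (@unip_congr m.+2) S (p ^ (s + rho 0 + \sum_(i < m) (r i.+1 - rho i))).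
Proof.
move=> Ss; apply: (fibre_covered (T := [set g v | v in S])) => [v Sv|]; first by exists v.
apply: covered_row_step (covered_box p_pr _) _ _ => [_ i [v Sv <-]|]; first exact: g_denS.
move=> _ _ [v Sv <-] [v' Sv' <-] gg'.
pose c j := tofrac (invmx k1 j ord0) : Qp.
have superE v0 : S v0 -> v0 ord0 (lift ord0 ord0) = \sum_j g v0 0 j * c j.
  move=> /S_P[x [h [k [uh _ vE]]]].
  have -> : v0 ord0 (lift ord0 ord0) = x 0 ord0 by rewrite vE; exact: border0l.
  rewrite {1}(gK x uh) -vE mxE; apply: eq_bigr => j _; congr (_ * _).
  (* The first column of the unipotent [h] is the first basis vector, so [h] drops out of the
     coefficients. *)
  rewrite !mxE; congr tofrac; rewrite (bigD1 ord0) //= big1 ?addr0.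
    by case: uh => -> _; rewrite mulr1.
  by move=> i i0; case: uh => _ ->; rewrite ?mulr0 // lt0n.
(* [w] is a lower triangular matrix times k1^-1 and its corner entry is 1, so [c ord0] is the
   inverse of [b0]. *)
pose b0 := (w *m k1^F) ord0 ord0.
have bc : b0 * c ord0 = 1.
  have := congr1 (fun M : 'M[Qp]_m.+1 => M ord0 ord0) (mapKmx w k1_unit).
  case: w_unip => -> _ <-; rewrite mxE (bigD1 ord0) //= big1 ?addr0.
    by congr (_ * _); rewrite mxE.
  move=> i i0; case: w_iwa => _ /is_trig_mxP -> //; first by rewrite mul0r.
  by rewrite lt0n.
have b0u : b0 * p%:R ^+ rho 0 \in punit.
  case: w_iwa => _ _ /(_ ord0); rewrite (big_pred1 ord0) //.
  by move=> j; rewrite /= leqn0.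
have DE : g v ord0 ord0 - g v' ord0 ord0 =
    (g v ord0 ord0 - g v' ord0 ord0) * (b0 * c ord0) by rewrite bc mulr1.
rewrite DE -pdenP exprD (mulf_swap4 _ _ _ (p%:R ^+ s)).
apply: rpredM; first exact: punit_int.
have -> : (g v ord0 ord0 - g v' ord0 ord0) * c ord0 =
    v ord0 (lift ord0 ord0) - v' ord0 (lift ord0 ord0) -
    \sum_(i < m) (g v 0 (lift ord0 i) - g v' 0 (lift ord0 i)) * c (lift ord0 i).
  rewrite (superE _ Sv) (superE _ Sv').
  exact: (dot_diff_recl (fun j => g v 0 j) (fun j => g v' 0 j) c).
rewrite mulrBl; apply: rpredB.
  by rewrite mulrBl; apply: rpredB; rewrite pdenP Ss.
by rewrite rpredM ?pint_pX // rpred_sum // => i _; rewrite rpredM ?pint_tofrac //; apply: gg'.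
Qed.

End Fibre.

(* On matrices of size n + 1, the count of unipotent matrices with almost integral
   superdiagonal saves the fraction 1 / saving_den n of the exponent. *)
Fixpoint saving_den (n : nat) : nat :=
  if n is n'.+1 then (n'.+2 * (saving_den n').+1)%N else 1%N.

(** Passing to the next size costs one factor R + 1 for each of the n' + 1 exponents of the lower
    right block. *)
Fixpoint log_exponent (n : nat) : nat :=
  if n is n'.+1 then (log_exponent n' + n'.+1)%N else 0%N.

Lemma saving_den_gt0 n : (0 < saving_den n)%N.
Proof. by case: n. Qed.

(** Put q = Q - 1. The hypotheses give P <= D q and r0 <= (D + 1) q, so the left side is at most (n
    + 2)(D + 1) q - q, which is at most R - Q. The recursion for [saving_den] is chosen for this
    inequality. *)
Lemma saving_step n D Q R P r0 rho0 : (n.+2 * D.+1 * Q < R + n.+2 * D.+1)%N ->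
  (P + D <= D * Q)%N -> (rho0 <= P)%N -> (r0 < Q + rho0)%N ->
  (P + n.+1 * r0 <= R - Q)%N.
Proof.
case: Q => [|q]; first by rewrite muln0; lia.
rewrite !(mulnS _ q) => h1 h2 h3 h4.
have h5 : (r0 <= q + D * q)%N by lia.
have h6 : (n.+1 * r0 <= n.+1 * (q + D * q))%N by rewrite leq_mul2l h5 orbT.
have e : (n.+2 * D.+1 * q = n.+1 * (q + D * q) + q + D * q)%N.
  by rewrite -mulnA mulSn (mulSn D q); lia.
lia.
Qed.

Section MainCount.
Local Open Scope classical_set_scope.
Variables (p : nat) (p_pr : prime p).
Local Notation Zp := (padic_int p_pr).
Local Notation Qp := (padic p_pr).
Local Notation "k ^F" := (map_mx (@tofrac Zp) k) (at level 2, format "k ^F").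
Let p_gt1 : (1 < p)%N := prime_gt1 p_pr.

(* The condition on v for v^-1 N u' to lie in GL(Z_p) for some u' in U(Q_p). *)
Definition iwa_set n (r : nat -> nat) : set 'M[Qp]_n.+1 :=
  [set v | unip v /\ exists k, iwa v k r].

Definition superdiag_le n s (v : 'M[Qp]_n.+1) :=
  forall j : 'I_n, (pden (v (widen_ord (leqnSn n) j) (lift ord0 j)) <= s)%N.

Lemma eq_iwa n (v : 'M[Qp]_n.+1) k (r r' : nat -> nat) :
  (forall i : 'I_n.+1, r i = r' i) -> iwa v k r -> iwa v k r'.
Proof. by move=> e [ku kt kP]; split => // i; rewrite -e. Qed.

Lemma unip_drsubmx n (v : 'M[Qp]_n.+2) : unip v ->
  let w := @drsubmx _ 1 n.+1 1 n.+1 v in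
  unip w /\ v = block_mx (1%:M : 'M[Qp]_1) (@ursubmx _ 1 n.+1 1 n.+1 v) 0 w.
Proof. by move=> /(@unip_blockP _ n.+1)[e u]. Qed.

Lemma superdiag_le_dr n s (v : 'M[Qp]_n.+2) : superdiag_le s v ->
  superdiag_le s (@drsubmx _ 1 n.+1 1 n.+1 v).
Proof.
move=> vs j; have := vs (lift ord0 j); congr (pden _ <= _)%N.
by rewrite !mxE; congr (v _ _); apply: val_inj.
Qed.

Lemma fibre_partition n (r rho : nat -> nat) (S : set 'M[Qp]_n.+2) (T : set 'M[Qp]_n.+1) B B' :
  (forall v, S v -> iwa_set r v) ->
  (forall v, S v -> exists k1, iwa (@drsubmx _ 1 n.+1 1 n.+1 v) k1 rho) ->
  (forall v, S v -> T (@drsubmx _ 1 n.+1 1 n.+1 v)) ->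
  covered (@unip_congr p p_pr n.+1) T B' ->
  (forall (w : 'M[Qp]_n.+1) (k1 : 'M[Zp]_n.+1) (S' : set 'M[Qp]_n.+2),
     unip w -> iwa w k1 rho -> S' `<=` S ->
     (forall v, S' v -> exists (x : 'rV[Qp]_n.+1) (h : 'M[Zp]_n.+1) k,
       [/\ unip h, iwa v k r & v = block_mx (1%:M : 'M[Qp]_1) x 0 (w *m h^F)]) ->
     covered (@unip_congr p p_pr n.+2) S' B) ->
  covered (@unip_congr p p_pr n.+2) S (B' * B).
Proof.
move=> Sr Srho ST cT cF.
apply: (covered_fib (f := fun v : 'M[Qp]_n.+2 => @drsubmx _ 1 n.+1 1 n.+1 v) ST cT) => l.
set S' := S `&` _.
(* The listed [l] need not be a block of an element of [S]. The block of some [v0] in its class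
   takes its place, and the other blocks differ from it by U(Z_p). *)
have [->|/set0P[v0 [Sv0 [h0 uh0 v0E]]]] := eqVneq S' set0; first exact: covered_set0.
have [k1 v0k1] := Srho _ Sv0.
have [uv0 _] := Sr _ Sv0; have [uw v0B] := unip_drsubmx uv0.
apply: (cF _ k1 _ uw v0k1) => [v [] //|v [Sv [h uh vE]]].
have [uv [k vk]] := Sr _ Sv; have [_ vB] := unip_drsubmx uv.
exists (@ursubmx _ 1 n.+1 1 n.+1 v); exists (invmx h0 *m h); exists k; split => //.
  by apply: unipM => //; exact: unip_invmx.
have e : @drsubmx _ 1 n.+1 1 n.+1 v =
    @drsubmx _ 1 n.+1 1 n.+1 v0 *m (invmx h0 *m h)^F.
  by rewrite v0E vE map_mxM !mulmxA mapKmx // unip_unitmx.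
by rewrite -e.
Qed.

(* Q is the exponent saved; for Q = 0 this is the trivial bound.  In the induction
   step either the lower right block already saves Q, or its exponent P is small;
   then r_0 is large and the condition on the entry (0, 1) saves r_0 - rho_0, or r_0
   is small too and the first row has few possible values. *)
Lemma count_unip n (r : nat -> nat) Q s : r n = 0%N ->
  let R := (\sum_(i < n.+1) r i)%N in
  (saving_den n * Q < R + saving_den n)%N ->
  covered (@unip_congr p p_pr n.+1)
    [set v | iwa_set r v /\ ((0 < Q)%N -> superdiag_le s v)]
    (R.+1 ^ log_exponent n * p ^ (R - Q + n * s)).
Proof.
elim: n r Q s => [|n IH] r Q s rn R QR.
  exists [:: 1%:M]; split; first by rewrite expn0 mul1n expn_gt0 ltnW.
  move=> v [[[v1 _] _] _]; exists 1%:M; rewrite ?inE //; exists 1%:M; first exact: unip1.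
  by rewrite map_mx1 mulmx1; apply/matrixP => i j; rewrite !ord1 v1 !mxE.
set S := [set v | _].
(* The exponents of the block are at most those of [v], hence at most R: finitely many profiles,
   each handled separately. *)
pose rho (phi : {ffun 'I_n.+1 -> 'I_R.+1}) (i : nat) : nat := phi (inord i).
pose F phi := S `&` [set v | exists k1, iwa (@drsubmx _ 1 n.+1 1 n.+1 v) k1 (rho phi)].
have r_le i : (i < n.+2)%N -> (r i <= R)%N.
  by move=> lti; rewrite /R (bigD1 (Ordinal lti)) //= leq_addr.
have SF v : S v -> exists phi, F phi v.
  move=> Sv; have [[uv [k vk]] _] := Sv; have [uw vB] := unip_drsubmx uv.
  have [k1 [rh wk1]] := unip_iwa uw.
  have le (i : 'I_n.+1) : (rh i < R.+1)%N.
    by rewrite ltnS (leq_trans (border_le vB vk wk1 i)) // r_le // ltnS ltn_ord.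
  exists [ffun i : 'I_n.+1 => inord (rh i)]; split => //; exists k1.
  by apply: eq_iwa wk1 => i; rewrite /rho ffunE inord_val inordK.
apply: (@covered_sub _ _ S S _ (#|{ffun 'I_n.+1 -> 'I_R.+1}| *
    (R.+1 ^ log_exponent n * p ^ (R - Q + n.+1 * s)))) => //.
  by rewrite card_ffun !card_ord mulnA -expnD [(n.+1 + _)%N]addnC.
apply: covered_union SF _ => phi.
have [->|/set0P[v0 [Sv0 [k0 v0k0]]]] := eqVneq (F phi) set0; first exact: covered_set0.
have rho_le (i : 'I_n.+1) : (rho phi i <= r i.+1)%N.
  have [[uv [k vk]] _] := Sv0; have [uw vB] := unip_drsubmx uv.
  exact: border_le vB vk v0k0 i.
have rhon : rho phi n = 0%N.
  by apply/eqP; rewrite -leqn0 -rn (rho_le ord_max).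
pose P := (\sum_(i < n.+1) rho phi i)%N.
pose S1 := (\sum_(i < n) (r i.+1 - rho phi i))%N.
have RE : R = (r 0 + S1 + P)%N.
  rewrite /R big_ord_recl -addnA; congr addn.
  rewrite /P !big_ord_recr /= rhon {1}rn !addn0 /S1 -big_split /=.
  by apply: eq_bigr => i _; rewrite subnK // (rho_le (widen_ord (leqnSn n) i)).
have P0 : (rho phi 0 <= P)%N by rewrite /P big_ord_recl leq_addr.
(* [Q'] is the saving requested from the block, [s'] the bound on its superdiagonal and [y] the
   exponent for a fibre. With [Q' = 0] the block is counted trivially. *)
have glue Q' s' y : (saving_den n * Q' < P + saving_den n)%N ->
    ((0 < Q')%N -> (0 < Q)%N /\ s' = s) ->
    (P - Q' + n * s' + y <= R - Q + n.+1 * s)%N ->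
    (forall (w : 'M[Qp]_n.+1) (k1 : 'M[Zp]_n.+1) (S' : set 'M[Qp]_n.+2),
     unip w -> iwa w k1 (rho phi) -> S' `<=` F phi ->
     (forall v, S' v -> exists (x : 'rV[Qp]_n.+1) (h : 'M[Zp]_n.+1) k,
       [/\ unip h, iwa v k r & v = block_mx (1%:M : 'M[Qp]_1) x 0 (w *m h^F)]) ->
     covered (@unip_congr p p_pr n.+2) S' (p ^ y)) ->
    covered (@unip_congr p p_pr n.+2) (F phi)
      (R.+1 ^ log_exponent n * p ^ (R - Q + n.+1 * s)).
  move=> hQ' hs hy cF.
  have := fibre_partition (S := F phi) _ _ _ (IH (rho phi) Q' s' rhon hQ') cF.
  move=> h; apply: (covered_sub _ _ (h _ _ _)) => //.
  - rewrite -mulnA -expnD leq_mul //; last by rewrite leq_pexp2l // ltnW.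
    by rewrite -/P RE; case: (log_exponent n) => // e; rewrite leq_exp2r // ltnS leq_addl.
  - by move=> v [[]].
  - by move=> v [_].
  - move=> v [[[uv [k vk]] Qs] [k1 wk1]]; have [uw vB] := unip_drsubmx uv.
    split; first by split => //; exists k1.
    by move=> Q'0; have [Q0 ->] := hs Q'0; exact/superdiag_le_dr/Qs.
have P_lt : (saving_den n * 0 < P + saving_den n)%N by rewrite muln0 addn_gt0 saving_den_gt0 orbT.
case: (ltnP (saving_den n * Q) (P + saving_den n)) => [QP|QP].
  (* Keeps the natural subtraction [P - Q] from truncating. *)
  have QleP : (Q <= P)%N.
    rewrite leqNgt; apply/negP => lt; move: QP; apply/negP; rewrite -leqNgt.
    apply: leq_trans (leq_mul (leqnn _) lt).
    by rewrite mulnS addnC leq_add2l leq_pmull // saving_den_gt0.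
  apply: (glue Q s (r 0 + S1)%N QP) => // [|w k1 S' uw wk1 _ S'P]; last first.
    by have h := fibre_covered_box uw wk1 S'P; exact: h.
  rewrite mulSn.
  have arith R' r0 S2 P' t : R' = (r0 + S2 + P')%N -> (Q <= P')%N ->
    (P' - Q + t + (r0 + S2) <= R' - Q + (s + t))%N by lia.
  exact: arith RE QleP.
have Q0 : (0 < Q)%N.
  by case: (posnP Q) QP => // ->; rewrite muln0 leqn0 addn_eq0 [saving_den n == _]eqn0Ngt saving_den_gt0 andbF.
have [le|lt] := leqP (Q + rho phi 0) (r 0).
  apply: (glue 0%N 0%N (s + rho phi 0 + S1)%N P_lt) => // [|w k1 S' uw wk1 S'F S'P].
    rewrite muln0 subn0 addn0 mulSn.
    have arith R' r0 S2 P' a t : R' = (r0 + S2 + P')%N -> (Q + a <= r0)%N ->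
      (P' + (s + a + S2) <= R' - Q + (s + t))%N by lia.
    exact: arith RE le.
  apply: (fibre_covered_superdiag uw wk1 S'P) => v /S'F[[_ Qs] _].
  have := Qs Q0 ord0; congr (pden _ <= _)%N.
  by congr (v _ _); apply: val_inj.
apply: (glue 0%N 0%N (n.+1 * r 0)%N P_lt) => // [|w k1 S' uw wk1 _ S'P]; last first.
  by have h := fibre_covered_cube uw wk1 S'P; exact: h.
rewrite muln0 subn0 addn0; apply: leq_trans (leq_addr _ _).
exact: saving_step QR QP P0 lt.
Qed.

End MainCount.

(** * Antidiagonal matrices and the long Weyl element *)

Section AntiDiagonal.
Variables (A : comNzRingType) (n : nat) (s : 'I_n.+1 -> A).

Definition antidiag : 'M[A]_n.+1 := \matrix_(i, j) if (i + j == n)%N then s i else 0.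

Lemma add_ord_eq_rev (i j : 'I_n.+1) : (i + j == n)%N = (j == rev_ord i).
Proof.
rewrite -val_eqE /= subSS; have := ltn_ord i; rewrite ltnS => lei.
by rewrite -[X in _ == X](subnKC lei) eqn_add2l.
Qed.

Lemma mul_antidiag (a : 'M[A]_n.+1) i j : (antidiag *m a) i j = s i * a (rev_ord i) j.
Proof.
rewrite mxE (bigD1 (rev_ord i)) //= big1 ?addr0; first by rewrite mxE add_ord_eq_rev eqxx.
by move=> k /negPf ki; rewrite mxE add_ord_eq_rev ki mul0r.
Qed.

Lemma antidiag_mul (a : 'M[A]_n.+1) i j :
  (a *m antidiag) i j = a i (rev_ord j) * s (rev_ord j).
Proof.
rewrite mxE (bigD1 (rev_ord j)) //= big1 ?addr0.
  by rewrite mxE addnC add_ord_eq_rev eqxx.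
move=> k ki; rewrite mxE addnC add_ord_eq_rev; case: eqP => [e|]; last by rewrite mulr0.
by rewrite e eqxx in ki.
Qed.

Lemma ltn_rev_ord (i j : 'I_n.+1) : (rev_ord i < rev_ord j)%N = (j < i)%N.
Proof. by rewrite /= !subSS ltn_sub2lE // -ltnS ltn_ord. Qed.

End AntiDiagonal.

Lemma w_longE (A : comUnitRingType) n :
  intmx A (w_long n) = antidiag (fun i => (-1) ^+ (n - i) : A).
Proof.
apply/matrixP => i j; rewrite !mxE; case: ifP => // _.
by rewrite rmorphXn rmorphN1.
Qed.

Lemma w_long_sqr (A : comUnitRingType) n :
  intmx A (w_long n) *m intmx A (w_long n) = ((-1) ^+ n)%:M.
Proof.
rewrite w_longE; apply/matrixP => i j; rewrite mul_antidiag !mxE add_ord_eq_rev rev_ordK eq_sym.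
have := ltn_ord i; rewrite ltnS => lei.
case: eqP => [->|_]; last by rewrite mulr0.
rewrite mulr1n -exprD; congr (_ ^+ _); rewrite /= subSS; lia.
Qed.

Lemma w_long_unit (A : comUnitRingType) n : intmx A (w_long n) \in unitmx.
Proof.
suff [] : intmx A (w_long n) \in unitmx /\ ((-1) ^+ n *: intmx A (w_long n)) \in unitmx by [].
apply: mulmx1_unit; rewrite -scalemxAr w_long_sqr -scalemx1 scalerA -exprD.
by rewrite addnn -mul2n exprM sqrrN expr1n expr1n scale1r.
Qed.

(* Conjugation by w_long exchanges upper and lower triangular matrices, hence U_w = U. *)
Lemma unip_w_long (A : comUnitRingType) n : @unip_w A n.+1 (w_long n) = @unip A n.+1.
Proof.
apply/seteqP; split=> [u []//|u uu]; split=> //.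
set W := intmx A (w_long n); have Wu : W \in unitmx by exact: w_long_unit.
pose c := (-1) ^+ n *: (W *m u *m W).
have cE i j : c i j = (-1) ^+ (n + (n - i) + (n - rev_ord j)) * u (rev_ord i) (rev_ord j).
  rewrite mxE /W w_longE antidiag_mul mul_antidiag !exprD -!mulrA; congr (_ * (_ * _)).
  by rewrite mulrC.
exists (c^T); last first.
  rewrite trmxK -/W /c -scalemxAr -scalemxAl !mulmxA mulVmx // mul1mx -mulmxA.
  rewrite w_long_sqr mul_mx_scalar scalerA -exprD addnn -mul2n exprM sqrrN !expr1n.
  by rewrite scale1r.
case: uu => u1 u0; split=> [i|i j ij].
  have := ltn_ord i; rewrite ltnS mxE cE u1 mulr1 => lei.
  have -> : (n + (n - i) + (n - rev_ord i) = 2 * n)%N by rewrite /= subSS; lia.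
  by rewrite exprM sqrrN !expr1n.
by rewrite mxE cE u0 ?mulr0 // ltn_rev_ord.
Qed.

(** * Double cosets and the torus action *)

Section CosetStructure.
Local Open Scope classical_set_scope.
Variables (p : nat) (p_pr : prime p) (n : nat).
Local Notation Zp := (padic_int p_pr).
Local Notation Qp := (padic p_pr).
Local Notation "k ^F" := (map_mx (@tofrac Zp) k) (at level 2, format "k ^F").
Variable s : 'I_n.+1 -> Qp.
Hypothesis s_neq0 : forall i, s i != 0.
Local Notation N := (antidiag s).
Local Notation w := (w_long n).
Local Notation Mat := 'M[Qp]_n.+1.

(** The quotient u'^-1 u is upper unipotent, and it is also lower triangular, being the conjugate by
    [N] of an upper unipotent matrix; so it is 1. *)
Lemma bruhat_uniq (u v u' v' : Mat) : unip u -> unip v -> unip u' -> unip v' ->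
  u *m N *m v = u' *m N *m v' -> u = u' /\ v = v'.
Proof.
move=> uu uv uu' uv' e.
have [utu vtu] := (unip_unitmx uu', unip_unitmx uv).
pose a := invmx u' *m u; pose c := v' *m invmx v.
have ac : a *m N = N *m c.
  rewrite /a /c mulmxA -[LHS](mulmxK vtu); congr (_ *m _).
  by rewrite -!mulmxA (mulmxA u) e !mulmxA mulVmx // mul1mx.
have ua : unip a by apply: unipM => //; exact: unip_invmx.
have uc : unip c by apply: unipM => //; exact: unip_invmx.
have a1 : a = 1%:M.
  apply/matrixP => i k; rewrite [RHS]mxE; case: (ltngtP i k) => [lt|gt|/val_inj ->].
  - have := congr1 (fun M : Mat => M i (rev_ord k)) ac.
    rewrite antidiag_mul mul_antidiag rev_ordK.
    case: uc => _ -> ; last by rewrite ltn_rev_ord.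
    move=> /eqP; rewrite mulr0 mulf_eq0 (negPf (s_neq0 k)) orbF => /eqP ->.
    by case: eqP lt => // ->; rewrite ltnn.
  - by case: ua => _ -> //; case: eqP gt => // ->; rewrite ltnn.
  - by case: ua => -> _; rewrite eqxx.
have c1 : c = 1%:M.
  apply/matrixP => i j; have := congr1 (fun M : Mat => M (rev_ord i) j) ac.
  rewrite a1 mul1mx -[in LHS](mulmx1 N) !mul_antidiag !rev_ordK.
  by move=> /(mulfI (s_neq0 _)).
split; first by rewrite -[u](mulKVmx utu) -/a a1 mulmx1.
by rewrite -[v'](mulmxKV vtu) -/c c1 mul1mx.
Qed.

Lemma bruhatE (u v : Mat) : unip u -> unip v -> bruhat w N (u *m N *m v) = (u, v).
Proof.
move=> uu uv; apply: xget_unique; first by split; rewrite ?unip_w_long.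
move=> [u' v'] /= [uu' uv' e]; rewrite unip_w_long in uv'.
by have [-> ->] := bruhat_uniq uu uv uu' uv' e.
Qed.

Lemma unip_F (g : 'M[Zp]_n.+1) : unip g -> unip (g^F).
Proof. exact: unip_map. Qed.

Lemma unip_F_inv (g : 'M[Zp]_n.+1) : unip (g^F) -> unip g.
Proof.
move=> [g1 g0]; split=> [i|i j ij]; apply/eqP; rewrite -(tofrac_eq (g i _)).
  by rewrite tofrac1; have := g1 i; rewrite mxE => ->.
by rewrite tofrac0; have := g0 i j ij; rewrite mxE => ->.
Qed.

Lemma double_cosetP (x y : Mat) : double_coset w x y <->
  exists g h : 'M[Zp]_n.+1, [/\ unip g, unip h & y = g^F *m x *m h^F].
Proof.
split=> [[_ [g ug <-] [b [h]]]|[g [h [ug uh ->]]]].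
  by rewrite unip_w_long => uh <- <-; exists g; exists h.
exists (g^F); first by exists g.
by exists (h^F) => //; exists h; rewrite ?unip_w_long.
Qed.

Lemma mapVKmx m k (g : 'M[Zp]_m) (x : 'M[Qp]_(m, k)) : g \in unitmx ->
  (invmx g)^F *m (g^F *m x) = x.
Proof. by move=> gu; rewrite mulmxA -map_mxM mulVmx // map_mx1 mul1mx. Qed.

Lemma double_coset_sub (x y : Mat) : double_coset w x y -> double_coset w y `<=` double_coset w x.
Proof.
move=> /double_cosetP[g [h [ug uh ->]]] z /double_cosetP[g' [h' [ug' uh' ->]]].
apply/double_cosetP; exists (g' *m g); exists (h *m h').
by split; [exact: unipM | exact: unipM | rewrite !map_mxM !mulmxA].
Qed.

Lemma double_coset_sym (x y : Mat) : double_coset w x y -> double_coset w y x.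
Proof.
move=> /double_cosetP[g [h [ug uh ->]]]; apply/double_cosetP.
exists (invmx g); exists (invmx h); split; [exact: unip_invmx|exact: unip_invmx|].
by rewrite -!mulmxA mapVKmx ?unip_unitmx // -map_mxM mulmxV ?unip_unitmx // map_mx1 mulmx1.
Qed.

Lemma double_coset_eq (x y : Mat) : double_coset w x y -> double_coset w y = double_coset w x.
Proof.
by move=> xy; apply/seteqP; split; apply: double_coset_sub => //; exact: double_coset_sym.
Qed.

Lemma double_coset_refl (x : Mat) : double_coset w x x.
Proof.
apply/double_cosetP; exists 1%:M; exists 1%:M; split; [exact: unip1|exact: unip1|].
by rewrite map_mx1 mul1mx mulmx1.
Qed.

(** [Kl] evaluates its terms at the representative chosen by [xget]; this determines the factors of
    that representative up to integral matrices. *)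
Lemma double_coset_bruhat (u v : Mat) : unip u -> unip v ->
  exists g h : 'M[Zp]_n.+1, [/\ unip g, unip h &
    bruhat w N (xget 0 (double_coset w (u *m N *m v))) = (g^F *m u, v *m h^F)].
Proof.
move=> uu uv; set X := double_coset w _.
have : X (xget 0 X) by apply: xgetPex; exists (u *m N *m v); exact: double_coset_refl.
move=> /double_cosetP[g [h [ug uh ->]]]; exists g; exists h; split => //.
have -> : g^F *m (u *m N *m v) *m h^F = (g^F *m u) *m N *m (v *m h^F) by rewrite !mulmxA.
by apply: bruhatE; apply: unipM => //; exact: unip_F.
Qed.

Lemma GL_double_coset (x y : Mat) : double_coset w x y -> GL_Zp x -> GL_Zp y.
Proof.
move=> /double_cosetP[g [h [ug uh ->]]] [k ku <-].
exists (g *m k *m h); last by rewrite /to_Qp !map_mxM.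
by rewrite /= !unitmx_mul (unip_unitmx ug) (unip_unitmx uh) andbT; exact: ku.
Qed.

Definition uX (X : set Mat) := (bruhat w N (xget 0 X)).1.
Definition vX (X : set Mat) := (bruhat w N (xget 0 X)).2.

Lemma X_setP (X : set Mat) : X_set w N X ->
  [/\ unip (uX X), unip (vX X), GL_Zp (uX X *m N *m vX X)
    & X = double_coset w (uX X *m N *m vX X)].
Proof.
move=> [x [[u uu [v uv <-]] GLx] <-].
have [g [h [ug uh e]]] := double_coset_bruhat uu uv.
rewrite /uX /vX e /=; have xx : double_coset w (u *m N *m v) (g^F *m u *m N *m (v *m h^F)).
  by apply/double_cosetP; exists g; exists h; rewrite !mulmxA.
split; [by apply: unipM => //; exact: unip_F|by apply: unipM => //; exact: unip_F| |].
  exact: GL_double_coset xx GLx.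
by rewrite (double_coset_eq xx).
Qed.

Lemma X_set_double_coset (u v : Mat) : unip u -> unip v -> GL_Zp (u *m N *m v) ->
  X_set w N (double_coset w (u *m N *m v)).
Proof.
move=> uu uv GLx; exists (u *m N *m v) => //; split => //.
by exists u => //; exists v.
Qed.

(* X |-> u(X) is injective modulo U(Z_p). *)
Lemma X_set_inj (X X' : set Mat) l : X_set w N X -> X_set w N X' ->
  @unip_congr p p_pr n.+1 (invmx (uX X)) l -> @unip_congr p p_pr n.+1 (invmx (uX X')) l ->
  X = X'.
Proof.
move=> /X_setP[uu uv GLx XE] /X_setP[uu' uv' GLx' XE'] [h uh hE] [h' uh' hE'].
rewrite XE XE'; move: uu uv GLx uu' uv' GLx' hE hE' {XE XE'}.
move: (uX X) (vX X) (uX X') (vX X') => u v u' v' uu uv [k ku kE] uu' uv' [k' ku' kE'] hE hE'.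
have ut := unip_unitmx uu; have ut' := unip_unitmx uu'; have vt := unip_unitmx uv.
have hu := unip_unitmx uh; have hu' := unip_unitmx uh'.
pose H := invmx h' *m h; have uH : unip H by apply: unipM => //; exact: unip_invmx.
have u'E : u' = H^F *m u.
  rewrite -[LHS]mulmx1 -[RHS](mulKVmx ut'); congr (_ *m _).
  rewrite hE' /H (map_mxM _ (invmx h')) -!mulmxA (mulmxA h'^F) -map_mxM mulmxV //.
  by rewrite map_mx1 mul1mx mulmxA -hE mulVmx.
pose d := invmx v *m v'.
have kd : k'^F = H^F *m k^F *m d.
  have -> : k'^F = u' *m N *m v' by rewrite -kE'.
  have -> : k^F = u *m N *m v by rewrite -kE.
  by rewrite u'E /d -!mulmxA mulKVmx.
have dE : d = (invmx k *m (invmx H *m k'))^F.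
  by rewrite 2!map_mxM kd -!mulmxA mapVKmx ?unip_unitmx // mapVKmx.
have ud : unip d by apply: unipM => //; exact: unip_invmx.
symmetry; apply: double_coset_eq; apply/double_cosetP.
exists H; exists (invmx k *m (invmx H *m k')); split => //.
  by apply: unip_F_inv; rewrite -dE.
by rewrite -dE u'E /d -!mulmxA mulKVmx.
Qed.

End CosetStructure.

(** * Conjugation by diagonal matrices *)

Section DiagonalConjugation.
Variables (A : comUnitRingType) (m : nat).
Implicit Types (d c e : 'I_m -> A) (x : 'M[A]_m).

(** This is diag(d) x diag(e)^-1. The two sides are scaled independently because the torus moves an
    element of GL(Z_p) by [d] on the left and by the reversed [d] on the right. *)
Definition scalemx2 d e x : 'M[A]_m := \matrix_(i, k) (d i * x i k * (e k)^-1).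

Lemma scalemx2M d c e x y : (forall i, c i \is a GRing.unit) ->
  scalemx2 d c x *m scalemx2 c e y = scalemx2 d e (x *m y).
Proof.
move=> cu; apply/matrixP => i k; rewrite !mxE mulr_sumr mulr_suml.
by apply: eq_bigr => l _; rewrite !mxE !mulrA divrK.
Qed.

Lemma scalemx2_1 d : (forall i, d i \is a GRing.unit) -> scalemx2 d d 1%:M = 1%:M.
Proof.
move=> du; apply/matrixP => i k; rewrite !mxE; case: eqP => [->|_].
  by rewrite mulr1 divrr.
by rewrite mulr0 mul0r.
Qed.

Lemma scalemx2_unitmx d e x : (forall i, d i \is a GRing.unit) ->
  (forall i, e i \is a GRing.unit) -> x \in unitmx -> scalemx2 d e x \in unitmx.
Proof.
move=> du eu xu; suff : scalemx2 d e x *m scalemx2 e d (invmx x) = 1%:M.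
  by move/mulmx1_unit => [].
by rewrite scalemx2M // mulmxV // scalemx2_1.
Qed.

Lemma scalemx2_unip d x : (forall i, d i \is a GRing.unit) -> unip x -> unip (scalemx2 d d x).
Proof.
move=> du [x1 x0]; split=> [i|i j ij]; rewrite mxE; first by rewrite x1 mulr1 divrr.
by rewrite x0 // mulr0 mul0r.
Qed.

End DiagonalConjugation.

Lemma map_scalemx2 (A B : comUnitRingType) (f : {rmorphism A -> B}) m (d e : 'I_m -> A) x :
  (forall i, e i \is a GRing.unit) ->
  map_mx f (scalemx2 d e x) = scalemx2 (f \o d) (f \o e) (map_mx f x).
Proof.
by move=> eu; apply/matrixP => i k; rewrite !mxE !rmorphM /= rmorphV.
Qed.

(** [N] itself is fixed by the scaling with [d] and the reversed [d], so all inner factors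
    cancel. *)
Lemma scalemx2_antidiag (A : comUnitRingType) n (s d : 'I_n.+1 -> A) u v :
  (forall i, d i \is a GRing.unit) ->
  scalemx2 d d u *m antidiag s *m scalemx2 (d \o @rev_ord n.+1) (d \o @rev_ord n.+1) v =
  scalemx2 d (d \o @rev_ord n.+1) (u *m antidiag s *m v).
Proof.
move=> du; have e : antidiag s = scalemx2 d (d \o @rev_ord n.+1) (antidiag s).
  apply/matrixP => i j; rewrite !mxE add_ord_eq_rev; case: eqP => [->|_].
    by rewrite /= rev_ordK mulrC mulKr.
  by rewrite mulr0 mul0r.
by rewrite {1}e !scalemx2M // => i; exact: du.
Qed.

Section Torus.
Local Open Scope classical_set_scope.
Variables (p : nat) (p_pr : prime p) (n : nat).
Local Notation Zp := (padic_int p_pr).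
Local Notation Qp := (padic p_pr).
Local Notation "k ^F" := (map_mx (@tofrac Zp) k) (at level 2, format "k ^F").
Variable s : 'I_n.+1 -> Qp.
Hypothesis s_neq0 : forall i, s i != 0.
Local Notation N := (antidiag s).
Local Notation w := (w_long n).
Local Notation Mat := 'M[Qp]_n.+1.
Implicit Type d : 'I_n.+1 -> Zp.

Definition tconj d (u : Mat) : Mat := scalemx2 (@tofrac Zp \o d) (@tofrac Zp \o d) u.
Definition drev d : 'I_n.+1 -> Zp := d \o @rev_ord n.+1.

(* X |-> d X d' for d' = w^-1 d^-1 w; this choice of d' gives d N d' = N. *)
Definition torus_act d (X : set Mat) : set Mat :=
  double_coset w (tconj d (uX s X) *m N *m tconj (drev d) (vX s X)).

Section OneElement.
Variable d : 'I_n.+1 -> Zp.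
Hypothesis d_unit : forall i, d i \is a GRing.unit.
Let dF_unit i : (@tofrac Zp \o d) i \is a GRing.unit.
Proof. exact: (rmorph_unit (@tofrac Zp)). Qed.
Lemma tconjF (g : 'M[Zp]_n.+1) : tconj d (g^F) = (scalemx2 d d g)^F.
Proof. by rewrite /tconj (map_scalemx2 _ _ _ d_unit). Qed.

Lemma tconj_unip u : unip u -> unip (tconj d u).
Proof. by move=> uu; apply: scalemx2_unip uu; exact: dF_unit. Qed.

Lemma tconjM u v : tconj d (u *m v) = tconj d u *m tconj d v.
Proof. by symmetry; exact: (scalemx2M _ _ u v dF_unit). Qed.

Lemma tconj_bruhat u v :
  tconj d u *m N *m tconj (drev d) v =
  scalemx2 (@tofrac Zp \o d) (@tofrac Zp \o drev d) (u *m N *m v).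
Proof. exact: (scalemx2_antidiag s u v dF_unit). Qed.

Lemma GL_tconj u v : GL_Zp (u *m N *m v) -> GL_Zp (tconj d u *m N *m tconj (drev d) v).
Proof.
move=> [k ku kE]; exists (scalemx2 d (drev d) k).
  by apply: scalemx2_unitmx => // i; exact: d_unit.
by rewrite tconj_bruhat -kE /to_Qp map_scalemx2 // => i; exact: d_unit.
Qed.

End OneElement.

Lemma drev_unit d : (forall i, d i \is a GRing.unit) -> forall i, drev d i \is a GRing.unit.
Proof. by move=> du i; exact: du. Qed.

Lemma torus_actE d u v : (forall i, d i \is a GRing.unit) -> unip u -> unip v ->
  torus_act d (double_coset w (u *m N *m v)) =
  double_coset w (tconj d u *m N *m tconj (drev d) v).
Proof.
move=> du uu uv; have eu := drev_unit du.
have [g [h [ug uh e]]] := double_coset_bruhat s_neq0 uu uv.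
rewrite /torus_act /uX /vX e /=; apply: double_coset_eq; apply/double_cosetP.
exists (scalemx2 d d g); exists (scalemx2 (drev d) (drev d) h).
split; [exact: scalemx2_unip | exact: scalemx2_unip |].
by rewrite !tconjM // !tconjF // !mulmxA.
Qed.

Lemma torus_act_X d X : (forall i, d i \is a GRing.unit) -> X_set w N X ->
  X_set w N (torus_act d X).
Proof.
move=> du /(X_setP s_neq0)[uu uv GLx _]; have eu := drev_unit du.
by apply: X_set_double_coset; [exact: tconj_unip|exact: tconj_unip|exact: GL_tconj].
Qed.

Lemma tconjK d u : (forall i, d i \is a GRing.unit) ->
  tconj (fun i => (d i)^-1) (tconj d u) = u.
Proof.
move=> du; apply/matrixP => i k; rewrite !mxE /= !rmorphV // invrK.
have dF j : tofrac (d j) \is a @GRing.unit Qp by exact: (rmorph_unit (@tofrac Zp)).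
by rewrite -!mulrA (mulVr (dF k)) mulr1 (mulKr (dF i)).
Qed.

Lemma torus_actK d X : (forall i, d i \is a GRing.unit) -> X_set w N X ->
  torus_act (fun i => (d i)^-1) (torus_act d X) = X.
Proof.
move=> du XX; have eu := drev_unit du; have [uu uv GLx XE] := X_setP s_neq0 XX.
have du' i : (d i)^-1 \is a GRing.unit by rewrite unitrV.
have h : tconj (drev (fun i => (d i)^-1)) (tconj (drev d) (vX s X)) = vX s X.
  exact: (tconjK (vX s X) eu).
have := torus_actE du' (tconj_unip du uu) (tconj_unip eu uv).
by rewrite h (tconjK (uX s X) du) -XE.
Qed.

Lemma torus_act_inj d X X' : (forall i, d i \is a GRing.unit) ->
  X_set w N X -> X_set w N X' -> torus_act d X = torus_act d X' -> X = X'.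
Proof. by move=> du XX XX' e; rewrite -(torus_actK du XX) e torus_actK. Qed.

(** The fundamental coweight of index [j] at [y]: consecutive entries have ratio 1 except between j
    and j + 1, so conjugation changes a single superdiagonal entry. *)
Definition simple_coweight (j : 'I_n) (y : Zp) (i : 'I_n.+1) : Zp :=
  if (i <= j)%N then y else 1.

Lemma tconj_superdiag j y u (i : 'I_n) : y \is a GRing.unit ->
  tconj (simple_coweight j y) u (widen_ord (leqnSn n) i) (lift ord0 i) =
  u (widen_ord (leqnSn n) i) (lift ord0 i) * tofrac (if i == j then y else 1).
Proof.
move=> yu; rewrite !mxE /simple_coweight /= /bump leq0n add1n.
have y0 : tofrac y != 0 :> Qp by apply: punit_neq0; exact: punit_tofrac.
rewrite -val_eqE /=; case: (ltngtP i j) => ij.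
- by rewrite tofrac1 mulr1 mulrAC mulfV // mul1r.
- by rewrite tofrac1 invr1 mulr1 mul1r mulr1.
- by rewrite tofrac1 invr1 mulr1 mulrC.
Qed.

Lemma tconj_rev_superdiag j y v (i : 'I_n) : y \is a GRing.unit ->
  tconj (drev (simple_coweight j y)) v (widen_ord (leqnSn n) i) (lift ord0 i) =
  v (widen_ord (leqnSn n) i) (lift ord0 i) * tofrac (if i == rev_ord j then y^-1 else 1).
Proof.
move=> yu; rewrite !mxE /drev /simple_coweight /= /bump leq0n add1n.
have y0 : tofrac y != 0 :> Qp by apply: punit_neq0; exact: punit_tofrac.
have yV : tofrac y^-1 = (tofrac y)^-1 :> Qp by rewrite rmorphV.
have [lti ltj] := (ltn_ord i, ltn_ord j); rewrite -val_eqE /=.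
case: (ltngtP i (n - j.+1)) => ij.
- have -> : (n.+1 - i.+1 <= j)%N = false by apply/negbTE; rewrite -ltnNge; lia.
  have -> : (n.+1 - i.+2 <= j)%N = false by apply/negbTE; rewrite -ltnNge; lia.
  by rewrite tofrac1 invr1 mulr1 mul1r mulr1.
- have -> : (n.+1 - i.+1 <= j)%N by lia.
  have -> : (n.+1 - i.+2 <= j)%N by lia.
  by rewrite tofrac1 mulr1 mulrAC mulfV // mul1r.
- have -> : (n.+1 - i.+1 <= j)%N = false by apply/negbTE; rewrite -ltnNge; lia.
  have -> : (n.+1 - i.+2 <= j)%N by lia.
  by rewrite yV tofrac1 mul1r.
Qed.

(** If k = u N v is integral, then u^-1 k = N v, and reversing the columns makes this lower
    triangular with diagonal [s]. *)
Lemma bruhat_iwa_set (u v : Mat) (r : nat -> nat) : unip u -> unip v ->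
  (forall i : 'I_n.+1, (\prod_(j < n.+1 | (j <= i)%N) s j) * p%:R ^+ r i \in punit) ->
  GL_Zp (u *m N *m v) -> iwa_set r (invmx u).
Proof.
move=> uu uv sP [k ku kE]; split; first exact: unip_invmx.
pose J : 'M[Zp]_n.+1 := antidiag (fun=> 1).
have JJ : J *m J = 1%:M.
  apply/matrixP => i j; rewrite mul_antidiag mul1r !mxE add_ord_eq_rev rev_ordK eq_sym.
  by case: (i == j).
have Ju : J \in unitmx by case: (mulmx1_unit JJ).
have e : invmx u *m (k *m J)^F = N *m v *m antidiag (fun=> 1).
  rewrite map_mxM -[k^F]/(to_Qp k) kE !mulmxA mulVmx ?unip_unitmx // mul1mx; congr (_ *m _).
  by apply/matrixP => i j; rewrite !mxE; case: ifP; rewrite ?tofrac1 ?tofrac0.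
have eij i j : (invmx u *m (k *m J)^F) i j = s i * v (rev_ord i) (rev_ord j).
  by rewrite e antidiag_mul mulr1 mul_antidiag.
exists (k *m J); split; first by rewrite unitmx_mul Ju andbT; exact: ku.
  by apply/is_trig_mxP => i j ij; rewrite eij; case: uv => _ ->; rewrite ?mulr0 // ltn_rev_ord.
move=> i; rewrite (eq_bigr (fun j => s j)) // => j _.
by rewrite eij; case: uv => -> _; rewrite mulr1.
Qed.

Lemma superdiag_le_inv t (u : Mat) : unip u -> superdiag_le t u -> superdiag_le t (invmx u).
Proof.
move=> uu ut j; have := unip_mulr_superdiag j (unip_invmx uu) uu.
rewrite mulVmx ?unip_unitmx // [in LHS]mxE.
have -> : (widen_ord (leqnSn n) j == lift ord0 j) = false.
  by rewrite -val_eqE /= /bump /= add1n; apply/negbTE; rewrite neq_ltn ltnSn.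
by move=> /esym/eqP; rewrite addr_eq0 => /eqP ->; rewrite pden_opp.
Qed.

Lemma X_set_count (r : nat -> nat) Q t : r n = 0%N ->
  (forall i : 'I_n.+1, (\prod_(j < n.+1 | (j <= i)%N) s j) * p%:R ^+ r i \in punit) ->
  let R := (\sum_(i < n.+1) r i)%N in
  (saving_den n * Q < R + saving_den n)%N ->
  covered eq [set X | X_set w N X /\ ((0 < Q)%N -> superdiag_le t (uX s X))]
    (R.+1 ^ log_exponent n * p ^ (R - Q + n * t)).
Proof.
move=> rn sP R QR.
apply: (covered_inj (g := fun X => invmx (uX s X)) _ _ (count_unip p_pr t rn QR)).
  move=> X [XX Xt]; have [uu uv GLx _] := X_setP s_neq0 XX.
  by split; [exact: bruhat_iwa_set sP GLx | move=> /Xt; exact: superdiag_le_inv].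
by move=> X X' l [XX _] [XX' _]; exact: X_set_inj.
Qed.

End Torus.

(** * Averaging the Kloosterman sum over torus orbits *)

Section Averaging.
Variable C : numDomainType.

(** Each [act y] is an injection of the finite [S] into itself, hence a permutation, so the sum is
    unchanged when [F] is replaced by its mean over [Y]. *)
Lemma averaging_bound (T I : eqType) (S : seq T) (F : T -> C) (Y : seq I) (act : I -> T -> T)
    (B : C) : uniq S -> (0 < size Y)%N ->
  (forall y x, y \in Y -> x \in S -> act y x \in S) ->
  (forall y, y \in Y -> {in S &, injective (act y)}) ->
  (forall x, x \in S -> `|\sum_(y <- Y) F (act y x)| <= B * (size Y)%:R) ->
  `|\sum_(x <- S) F x| <= B * (size S)%:R.
Proof.
move=> uS Y0 actS actI FB.
have Y0' : (0 : C) < (size Y)%:R by rewrite ltr0n.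
have const (U : eqType) (r : seq U) (c : C) : \sum_(x <- r) c = c * (size r)%:R.
  by rewrite big_const_seq count_predT iter_addr addr0 mulr_natr.
rewrite -(ler_pM2r Y0') -[X in _ * X <= _](normr_nat _ (size Y)) -normrM.
have -> : (\sum_(x <- S) F x) * (size Y)%:R = \sum_(x <- S) \sum_(y <- Y) F (act y x).
  rewrite exchange_big /= -const; apply: eq_big_seq => y yY.
  rewrite -(big_map (act y) xpredT F); apply: perm_big; rewrite perm_sym.
  have um : uniq [seq act y x | x <- S] by rewrite map_inj_in_uniq // => ? ? ? ?; exact: actI.
  apply: uniq_perm => //; apply: (uniq_min_size um _ _).2; last by rewrite size_map.
  by move=> _ /mapP[x xS ->]; exact: actS.
apply: le_trans (ler_norm_sum _ _ _) _.
rewrite mulrAC -const big_seq [leRHS]big_seq; apply: ler_sum => x xS; exact: FB.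
Qed.

Lemma partition_bound (T : eqType) (L : finType) (S : seq T) (F : T -> C) (lab : T -> L)
    (W : L -> C) :
  (forall l, `|\sum_(x <- [seq x <- S | lab x == l]) F x|
               <= W l * (size [seq x <- S | lab x == l])%:R) ->
  `|\sum_(x <- S) F x| <= \sum_(x <- S) W (lab x).
Proof.
move=> h; rewrite (partition_big lab xpredT) //= [leRHS](partition_big lab xpredT) //=.
apply: le_trans (ler_norm_sum _ _ _) _; apply: ler_sum => l _.
rewrite -big_filter; apply: le_trans (h l) _.
rewrite -[X in _ <= X]big_filter (eq_big_seq (fun=> W l)); last first.
  by move=> x; rewrite mem_filter => /andP[/eqP -> _].
by rewrite big_const_seq count_predT iter_addr addr0 mulr_natr.
Qed.

End Averaging.

Section KlBound.
Local Open Scope classical_set_scope.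
Variables (R : realType) (p : nat) (p_pr : prime p) (n : nat).
Local Notation Zp := (padic_int p_pr).
Local Notation Qp := (padic p_pr).
Local Notation C := R[i].
Local Notation "k ^F" := (map_mx (@tofrac Zp) k) (at level 2, format "k ^F").
Variable s : 'I_n.+1 -> Qp.
Hypothesis s_neq0 : forall i, s i != 0.
Local Notation N := (antidiag s).
Local Notation w := (w_long n).
Local Notation Mat := 'M[Qp]_n.+1.
Variables psi psi' : 'I_n -> int.

Let sd (u : Mat) (j : 'I_n) : Qp := u (widen_ord (leqnSn n) j) (lift ord0 j).

Definition Kl_term (X : set Mat) : C :=
  unip_char R psi (uX s X) * unip_char R psi' (vX s X).

Let unip_char_mull (f : 'I_n -> int) (g : 'M[Zp]_n.+1) (u : Mat) : unip g -> unip u ->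
  unip_char R f (g^F *m u) = unip_char R f u.
Proof.
move=> ug uu; rewrite /unip_char.
under eq_bigr => j _ do rewrite (unip_mulr_superdiag j (unip_F ug) uu) mulrDr.
rewrite big_split /= padic_eD padic_e_int ?mul1r // rpred_sum // => j _.
by rewrite rpredM ?rpred_int // mxE pint_tofrac.
Qed.

Let unip_char_mulr (f : 'I_n -> int) (g : 'M[Zp]_n.+1) (u : Mat) : unip g -> unip u ->
  unip_char R f (u *m g^F) = unip_char R f u.
Proof.
move=> ug uu; rewrite /unip_char.
under eq_bigr => j _ do rewrite (unip_mulr_superdiag j uu (unip_F ug)) mulrDr.
rewrite big_split /= padic_eD [X in _ * X]padic_e_int ?mulr1 // rpred_sum // => j _.
by rewrite rpredM ?rpred_int // mxE pint_tofrac.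
Qed.

Lemma Kl_term_double_coset (u v : Mat) : unip u -> unip v ->
  Kl_term (double_coset w (u *m N *m v)) = unip_char R psi u * unip_char R psi' v.
Proof.
move=> uu uv; have [g [h [ug uh e]]] := double_coset_bruhat s_neq0 uu uv.
by rewrite /Kl_term /uX /vX e /= unip_char_mull // unip_char_mulr.
Qed.

Lemma norm_Kl_term X : `|Kl_term X| = 1.
Proof. by rewrite normrM !norm_padic_e mulr1. Qed.

Let al j X := (psi j)%:~R * sd (uX s X) j : Qp.
Let be j X := (psi' (rev_ord j))%:~R * sd (vX s X) (rev_ord j) : Qp.

Section Act.
Variables (j : 'I_n) (y : Zp) (X : set Mat).
Hypothesis y_unit : y \is a GRing.unit.
Hypothesis XX : X_set w N X.
Let d := simple_coweight j y.
Let d_unit i : d i \is a GRing.unit.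
Proof. by rewrite /d /simple_coweight; case: ifP; rewrite ?unitr1. Qed.

Let act_sd : exists g h : 'M[Zp]_n.+1, [/\ unip g, unip h,
  uX s (torus_act s d X) = g^F *m tconj d (uX s X) &
  vX s (torus_act s d X) = tconj (drev d) (vX s X) *m h^F].
Proof.
have [uu uv _ _] := X_setP s_neq0 XX.
have [g [h [ug uh e]]] := double_coset_bruhat s_neq0 (tconj_unip d_unit uu)
   (tconj_unip (drev_unit d_unit) uv).
by exists g; exists h; rewrite /uX /vX /torus_act e.
Qed.

(** Entries are multiplied by units and translated by integers. Hence the labels used to sort the
    double cosets are constant on torus orbits. *)
Lemma pden_act_uX (a : int) i :
  pden (a%:~R * sd (uX s (torus_act s d X)) i) = pden (a%:~R * sd (uX s X) i).
Proof.
have [uu uv _ _] := X_setP s_neq0 XX; have [g [h [ug uh -> _]]] := act_sd.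
rewrite /sd (unip_mulr_superdiag i (unip_F ug) (tconj_unip d_unit uu)).
rewrite tconj_superdiag // mulrDr addrC pden_addr; last first.
  by rewrite rpredM ?rpred_int // mxE pint_tofrac.
by rewrite mulrA pden_mulr_unit // punit_tofrac //; case: ifP; rewrite ?unitr1.
Qed.

Lemma pden_act_vX (a : int) i :
  pden (a%:~R * sd (vX s (torus_act s d X)) i) = pden (a%:~R * sd (vX s X) i).
Proof.
have [uu uv _ _] := X_setP s_neq0 XX; have [g [h [ug uh _ ->]]] := act_sd.
have ut : unip (tconj (drev d) (vX s X)) by exact: (tconj_unip (drev_unit d_unit) uv).
rewrite /sd (unip_mulr_superdiag i ut (unip_F uh)) tconj_rev_superdiag // mulrDr pden_addr; last first.
  by rewrite rpredM ?rpred_int // mxE pint_tofrac.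
by rewrite mulrA pden_mulr_unit // punit_tofrac //; case: ifP; rewrite ?unitr1 ?unitrV.
Qed.

Let char_single (f : 'I_n -> int) (x : 'I_n -> Qp) (k : 'I_n) (z : Zp) :
  padic_e R (\sum_i (f i)%:~R * (x i * tofrac (if i == k then z else 1))) =
  padic_e R (\sum_(i | i != k) (f i)%:~R * x i) * padic_e R ((f k)%:~R * x k * tofrac z).
Proof.
rewrite (bigD1 k) //= eqxx addrC padic_eD mulrA; congr (padic_e R _ * _).
by apply: eq_bigr => i /negPf ->; rewrite tofrac1 mulr1.
Qed.

Lemma Kl_term_act : Kl_term (torus_act s d X) =
  padic_e R (\sum_(i | i != j) (psi i)%:~R * sd (uX s X) i) *
  padic_e R (\sum_(i | i != rev_ord j) (psi' i)%:~R * sd (vX s X) i) *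
  padic_e R (al j X * tofrac y + be j X * tofrac y^-1).
Proof.
have [uu uv _ _] := X_setP s_neq0 XX.
rewrite Kl_term_double_coset; [|exact: tconj_unip|exact: (tconj_unip (drev_unit d_unit) uv)].
rewrite padic_eD /unip_char.
under eq_bigr => i _ do rewrite tconj_superdiag //.
rewrite (char_single psi (sd (uX s X)) j y).
under [X in _ * padic_e R X]eq_bigr => i _ do rewrite tconj_rev_superdiag //.
rewrite (char_single psi' (sd (vX s X)) (rev_ord j) y^-1).
by rewrite mulrACA.
Qed.

End Act.
End KlBound.

Lemma mulf_shuffle (F : fieldType) (a b c x d : F) :
  a * b * c * x * d = x * (d * c) * (a * b).
Proof. by ring. Qed.

Lemma pden_intM (p : nat) (p_pr : prime p) (c : int) (x : padic p_pr) : c != 0 ->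
  (pden x <= pden (c%:~R * x)%R + logn p `|c|)%N.
Proof.
move=> c0; have c0' : (0 < `|c|)%N by rewrite absz_gt0.
have [k cop kE] := pfactor_coprime p_pr c0'.
have ku : (k%:R : padic p_pr) \in punit.
  rewrite -(rmorph_nat (@tofrac (padic_int p_pr))); apply: punit_tofrac.
  by rewrite padic_unitE residue_nat expn1 -/(dvdn _ _) -prime_coprime.
have su : ((-1) ^+ (c < 0)%R : padic p_pr) \in punit by exact: punit_sign.
rewrite -pdenP exprD; set v := logn p _ in kE *; set m := pden (_ * x).
have cE : c%:~R = (-1) ^+ (c < 0)%R * k%:R * p%:R ^+ v :> padic p_pr.
  by rewrite -natrX -mulrA -natrM -kE {1}[c]intEsign intrM rmorph_sign.
have : c%:~R * x * p%:R ^+ m \in pint by rewrite pdenP.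
rewrite cE => h; rewrite -(pint_mulr_unit _ (punitM su ku)); move: h.
by congr (_ \in pint); exact: mulf_shuffle.
Qed.

Section KlSum.
Local Open Scope classical_set_scope.
Variables (R : realType) (p : nat) (p_pr : prime p) (n : nat).
Local Notation Zp := (padic_int p_pr).
Local Notation Qp := (padic p_pr).
Local Notation C := R[i].
Variable s : 'I_n.+1 -> Qp.
Hypothesis s_neq0 : forall i, s i != 0.
Local Notation N := (antidiag s).
Local Notation w := (w_long n).
Variables psi psi' : 'I_n -> int.
Local Notation sd u j := (u (widen_ord (leqnSn n) j) (lift ord0 j)).

Variables (r : nat -> nat) (Q t : nat) (B : R).
Hypothesis rn : r n = 0%N.
Hypothesis sP : forall i : 'I_n.+1,
  (\prod_(j < n.+1 | (j <= i)%N) s j) * p%:R ^+ r i \in punit.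
Hypothesis psi_neq0 : forall j, psi j != 0.
Hypothesis B_ge0 : 0 <= B.
Hypothesis BP : forall j m, (t < m + logn p `|psi j|)%N -> 4 ^+ 12 <= B ^+ 12 * p%:R ^+ m.
Local Notation R0 := (\sum_(i < n.+1) r i)%N.
Hypothesis QP : (saving_den n * Q < R0 + saving_den n)%N.

Lemma size_covered (T : choiceType) (P : set T) (S : seq T) b : uniq S ->
  (forall x, x \in S -> P x) -> covered eq P b -> (size S <= b)%N.
Proof.
move=> uS SP [L [sL LP]]; apply: leq_trans sL; apply: uniq_leq_size => // x /SP/LP.
by move=> [l lL ->].
Qed.

Lemma X_set_finite : finite_set (X_set w N).
Proof.
have [|L [_ LP]] := X_set_count s_neq0 0 rn sP (Q := 0%N).
  by rewrite muln0 addn_gt0 saving_den_gt0 orbT.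
apply: sub_finite_set (finite_seq L) => X XX.
by have [|l lL ->] := LP X; first by split.
Qed.

Let lab_j (X : set 'M[Qp]_n.+1) := [pick j | (t < pden (sd (uX s X) j))%N].
Let den j X := maxn (pden ((psi j)%:~R * sd (uX s X) j))
  (pden ((psi' (rev_ord j))%:~R * sd (vX s X) (rev_ord j))).

(** Fixing [j] and [m] gives a class stable under the torus on which one set of units, those modulo
    [p ^ m], serves all elements. *)
Lemma class_bound (S : seq (set 'M[Qp]_n.+1)) j m : uniq S ->
  (forall X, (X \in S) <-> [/\ X_set w N X, lab_j X = Some j & den j X = m]) ->
  `|\sum_(X <- S) @Kl_term R p p_pr n s psi psi' X| <= B%:C%C * (size S)%:R.
Proof.
move=> uS SP.
refine (averaging_bound (Y := unit_reps p_pr m)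
  (act := fun y => torus_act s (simple_coweight j y)) uS (size_unit_reps p_pr m) _ _ _).
- move=> y X yY /SP[XX Xj Xm]; have yu := unit_reps_unit yY; apply/SP; split.
  + by apply: torus_act_X XX => // i; rewrite /simple_coweight; case: ifP; rewrite ?unitr1.
  + rewrite -Xj; apply: eq_pick => i; have := pden_act_uX s_neq0 j yu XX 1 i.
    by rewrite !mul1r => ->.
  + by rewrite -Xm /den (pden_act_uX s_neq0 j yu XX) (pden_act_vX s_neq0 j yu XX).
- move=> y yY X X' /SP[XX _ _] /SP[XX' _ _]; apply: torus_act_inj => // i.
  by rewrite /simple_coweight; case: ifP; rewrite ?unitr1 ?(unit_reps_unit yY).
move=> X /SP[XX Xj Xm].
rewrite (eq_big_seq _ (fun y yY => Kl_term_act R s_neq0 psi psi' j (unit_reps_unit yY) XX)).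
rewrite -mulr_sumr !normrM !norm_padic_e !mul1r.
have := unit_average R (esym Xm); set K := (`| _ |) => h.
(* Multiplying [u_jj] by [psi j] lowers the denominator exponent by at most the valuation of
   [psi j]. *)
have tm : (t < m + logn p `|psi j|)%N.
  have tu : (t < pden (sd (uX s X) j))%N.
    by move: Xj; rewrite /lab_j; case: pickP => // j' ? [<-].
  apply: leq_trans tu (leq_trans (pden_intM _ (psi_neq0 j)) _).
  by rewrite leq_add2r -Xm leq_maxl.
have := BP tm; rewrite -lecR => hB.
have pm : (0 : C) < (p ^ m)%:R by rewrite ltr0n expn_gt0 prime_gt0.
have K0 : K \is Num.nneg by rewrite nnegrE normr_ge0.
have BS0 : B%:C%C * (size (unit_reps p_pr m))%:R \is @Num.nneg C.
  by rewrite nnegrE mulr_ge0 ?ler0n ?ler0c.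
rewrite -(ler_pXn2r (isT : (0 < 12)%N) K0 BS0).
rewrite -(ler_pM2r pm); apply: le_trans h _.
rewrite natrX natrM exprMn [X in _ <= X * _]exprMn [leRHS]mulrAC; apply: ler_wpM2r.
  by rewrite exprn_ge0 // ler0n.
have e1 : (4 ^+ 12 : R)%:C%C = 4%:R ^+ 12 by rewrite rmorphXn rmorph_nat.
have e2 : (B ^+ 12 * p%:R ^+ m)%:C%C = B%:C%C ^+ 12 * (p ^ m)%:R.
  by rewrite -natrX rmorphM rmorphXn [in X in _ * X]rmorph_nat.
by rewrite -e1 -e2.
Qed.

Let natr_complex_affine (x y : nat) :
  (x%:R + B * y%:R)%:C%C = x%:R + B%:C%C * y%:R :> C.
Proof. by rewrite rmorphD rmorphM /= !rmorph_nat. Qed.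

(** Unlabelled terms are few, by the count with saving [Q]. Labelled ones are bounded by [B] on
    average and counted without saving. *)
Lemma Kl_sum_bound :
  ComplexField.Normc.normc (\sum_(X \in X_set w N) @Kl_term R p p_pr n s psi psi' X) <=
  (R0.+1 ^ log_exponent n * p ^ (R0 - Q + n * t))%:R +
    B * (R0.+1 ^ log_exponent n * p ^ R0)%:R.
Proof.
rewrite -lecR.
have -> : forall z : C, (ComplexField.Normc.normc z)%:C%C = `|z| by [].
rewrite fsbig_finite; last exact: X_set_finite.
have : forall X, X \in finmap.enum_fset (fset_set (X_set w N)) <-> X_set w N X.
  move=> X; rewrite [X \in _](in_fset_set X_set_finite X).
  by split => [/set_mem|/mem_set].
have := finmap.fset_uniq (fset_set (X_set w N)).
move: (finmap.enum_fset _) => S uS SP.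
(* A common bound for the denominators in the finite sum makes the set of labels finite. *)
pose M := (\max_(X <- S) \max_j den j X)%N.
have den_le j X : X \in S -> (den j X <= M)%N.
  move=> XS; apply: (@leq_trans (\max_j den j X)%N); first exact: leq_bigmax.
  exact: leq_bigmax_seq.
pose lab X : option ('I_n * 'I_M.+1) := if lab_j X is Some j then Some (j, inord (den j X)) else None.
pose W (l : option ('I_n * 'I_M.+1)) : C := if l is Some _ then B%:C%C else 1.
apply: le_trans (partition_bound (lab := lab) (W := W) _) _.
  move=> [[j m]|].
    apply: (class_bound (j := j) (m := m)); first by rewrite filter_uniq.
    move=> X; rewrite mem_filter /lab; split.
      move=> /andP[+ /SP XX]; case: (lab_j X) => // j' /eqP[-> <-].
      by split => //; rewrite inordK // ltnS den_le //; apply/SP.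
    move=> [XX -> e]; apply/andP; split; last exact/SP.
    by rewrite e inord_val.
  apply: le_trans (ler_norm_sum _ _ _) _; rewrite mul1r.
  rewrite (eq_bigr (fun=> 1)); first by rewrite big_const_seq count_predT iter_addr addr0.
  by move=> X _; exact: norm_Kl_term.
rewrite (bigID (fun X => lab_j X == None)) /= natr_complex_affine.
apply: lerD.
  rewrite -big_filter (eq_big_seq (fun=> 1)); last first.
    by move=> X; rewrite mem_filter /lab => /andP[/eqP -> _].
  rewrite big_const_seq count_predT iter_addr addr0 ler_nat.
  apply: size_covered (X_set_count s_neq0 t rn sP QP).
    by rewrite filter_uniq.
  move=> X; rewrite mem_filter => /andP[jN /SP XX]; split => // _ j.
  move: jN; rewrite /lab_j; case: pickP => // h _.
  by rewrite leqNgt h.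
rewrite -big_filter (eq_big_seq (fun=> B%:C%C)); last first.
  by move=> X; rewrite mem_filter /lab => /andP[+ _]; case: (lab_j X).
rewrite big_const_seq count_predT iter_addr addr0 -[leLHS]mulr_natr ler_wpM2l ?ler0c // ler_nat.
have [|L LP] := X_set_count s_neq0 0 rn sP (Q := 0%N).
  by rewrite muln0 addn_gt0 saving_den_gt0 orbT.
have := size_covered _ _ (ex_intro _ L LP); rewrite subn0 muln0 addn0; apply.
  by rewrite filter_uniq.
by move=> X; rewrite mem_filter => /andP[_ /SP XX]; split.
Qed.

End KlSum.

(** * Numerical form of the power saving *)

Lemma poly_le_expR (R : realType) (E : nat) (a : R) : 0 < a ->
  exists2 K : R, 0 < K & forall (k : nat) (l : R), ln 2 <= l ->
    k.+1%:R ^+ E <= K * expR (a * k%:R * l).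
Proof.
move=> a0; have l2 : 0 < ln 2 :> R by rewrite ln_gt0 // ltr1n.
pose b := a * ln 2; have b0 : 0 < b by rewrite mulr_gt0.
(* Ensures c E <= a ln 2, also for E = 0; since l >= ln 2, the constant is then uniform in the
   prime. *)
pose c := b / E.+1%:R; have c0 : 0 < c by rewrite divr_gt0.
exists (c ^- E * expR b); first by rewrite mulr_gt0 ?expR_gt0 // invr_gt0 exprn_gt0.
move=> k l ll.
have h1 : k.+1%:R <= c^-1 * expR (c * k.+1%:R).
  rewrite -ler_pdivrMl ?invr_gt0 // invrK.
  by apply: le_trans (expR_ge1Dx _); rewrite lerDr.
have h2 : k.+1%:R ^+ E <= c ^- E * expR (c * k.+1%:R) ^+ E.
  rewrite -exprVn -exprMn lerXn2r // nnegrE ?ler0n //.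
  by rewrite mulr_ge0 ?expR_ge0 // invr_ge0 ltW.
apply: le_trans h2 _; rewrite -[leRHS]mulrA ler_wpM2l ?invr_ge0 ?exprn_ge0 ?(ltW c0) //.
rewrite -expRM_natr -expRD ler_expR.
have h3 : c * k.+1%:R * E%:R <= b * k.+1%:R.
  rewrite mulrAC ler_wpM2r ?ler0n // /c -mulrA ler_piMr ?(ltW b0) //.
  by rewrite mulrC ler_pdivrMr ?ltr0n // mul1r ler_nat.
apply: le_trans h3 _; rewrite -(natr1 k) mulrDr mulr1 addrC lerD2l /b -mulrA.
by rewrite [ln 2 * _]mulrC mulrA ler_wpM2l // mulr_ge0 ?ler0n ?(ltW a0).
Qed.

Lemma natrX_expR (R : realType) (p k : nat) : (0 < p)%N ->
  (p ^ k)%:R = expR (k%:R * ln p%:R) :> R.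
Proof. by move=> p0; rewrite natrX expRM_natl lnK // posrE ltr0n. Qed.

(** Both terms are at most a constant times M (R0 + 1)^E p^((1 - eta) R0) with eta = 1/(24 n D): the
    first since e <= (1 - 1/(2D)) R0, the second since (t + 1)/12 >= eta R0. Half of eta absorbs the
    polynomial factor. *)
Lemma power_saving (R : realType) (n D E : nat) : (0 < n)%N -> (0 < D)%N ->
  exists2 delta : R, 0 < delta & exists2 K : R, 0 < K &
  forall (p R0 e t : nat) (M : R), (1 < p)%N -> 1 <= M ->
    (2 * D * e + R0 <= 2 * D * R0)%N -> (R0 <= t.+1 * (2 * n * D))%N ->
    (R0.+1 ^ E * p ^ e)%:R +
      4 * M * expR (- (t.+1%:R * ln p%:R) / 12) * (R0.+1 ^ E * p ^ R0)%:R
    <= K * M * (p%:R ^+ R0) `^ (1 - delta).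
Proof.
move=> n0 D0; pose eta : R := (24 * n * D)%:R^-1.
have nD0 : (0 < 24 * n * D)%N by rewrite !muln_gt0 n0 D0.
have eta0 : 0 < eta by rewrite invr_gt0 ltr0n.
exists (eta / 2); first by rewrite divr_gt0.
have [K K0 KP] := poly_le_expR E (divr_gt0 eta0 (ltr0Sn R 1)).
exists (5 * K); first by rewrite mulr_gt0.
move=> p R0 e t M p1 M1 he ht.
have p0 : (0 < p)%N by apply: ltnW.
set l := ln p%:R; have l2 : ln 2 <= l by rewrite ler_ln ?posrE ?ltr0n // ler_nat.
have l0 : 0 < l by apply: lt_le_trans l2; rewrite ln_gt0 // ltr1n.
have -> : (p%:R ^+ R0) `^ (1 - eta / 2) = expR ((1 - eta / 2) * (R0%:R * l)).
  rewrite -natrX /powR gt_eqF; last by rewrite ltr0n expn_gt0 p0.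
  by rewrite natrX_expR // expRK.
rewrite !natrM; set A := (R0.+1 ^ E)%:R; rewrite !natrX_expR // -/l.
have hA : A <= K * expR (eta / 2 * R0%:R * l) by rewrite /A natrX; exact: KP.
have A0 : 0 <= A by rewrite /A ler0n.
set Y := expR ((1 - eta) * R0%:R * l).
have hY : expR (eta / 2 * R0%:R * l) * Y = expR ((1 - eta / 2) * (R0%:R * l)).
  by rewrite -expRD; congr expR; field.
have eta24 : eta * (24 * n * D)%:R = 1 by rewrite mulVf // pnatr_eq0 -lt0n.
have e1 : expR (e%:R * l) <= Y.
  rewrite ler_expR ler_wpM2r ?(ltW l0) //.
  have : (24 * n * D * e + R0)%:R <= (24 * n * D * R0)%:R :> R.
    rewrite ler_nat; have := leq_mul (leqnn (12 * n)) he.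
    rewrite mulnDr => he'; apply: leq_trans (leq_trans _ he') _; last by lia.
    by apply: leq_add; [lia | rewrite leq_pmull // muln_gt0].
  rewrite natrD !(natrM _ (24 * n * D)%N) => /(ler_wpM2l (ltW eta0)).
  by rewrite mulrDr !mulrA eta24 !mul1r; lra.
have e2 : expR (- (t.+1%:R * l) / 12) * expR (R0%:R * l) <= Y.
  rewrite -expRD ler_expR.
  have : (12 * R0)%:R <= (t.+1 * (24 * n * D))%:R :> R.
    by rewrite ler_nat; apply: leq_trans (leq_mul (leqnn 12) ht) _; lia.
  rewrite natrM (natrM _ t.+1) => /(ler_wpM2l (ltW eta0)).
  by rewrite [leRHS]mulrCA eta24 mulr1 => /(ler_wpM2r (ltW l0)); lra.
have M0 : 0 <= M by apply: le_trans M1.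
have t1 : A * expR (e%:R * l) <= M * (A * Y).
  by apply: le_trans (ler_peMl _ M1); rewrite ?mulr_ge0 ?expR_ge0 // ler_wpM2l.
have t2 : 4 * M * expR (- (t.+1%:R * l) / 12) * (A * expR (R0%:R * l)) <= 4 * M * (A * Y).
  rewrite -[leLHS]mulrA ler_wpM2l ?mulr_ge0 // mulrCA ler_wpM2l //.
apply: le_trans (lerD t1 t2) _.
have -> : M * (A * Y) + 4 * M * (A * Y) = 5 * M * (A * Y) by ring.
have -> : 5 * K * M * expR ((1 - eta / 2) * (R0%:R * l)) =
    5 * M * (K * expR (eta / 2 * R0%:R * l) * Y) by rewrite -hY; ring.
by rewrite ler_wpM2l ?mulr_ge0 // ler_wpM2r // expR_ge0.
Qed.

Lemma mulf_telescope (F : fieldType) (x a b e : F) : b != 0 ->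
  x * (a / b * e) * b = x * a * e.
Proof. by move=> b0; field. Qed.

Lemma saving_exponent D Q R x : (Q <= R)%N -> (R <= D * Q)%N -> (2 * x <= Q)%N ->
  (2 * D * (R - Q + x) + R <= 2 * D * R)%N.
Proof.
move=> QR RD xQ.
have -> : (2 * D * R = 2 * D * (R - Q) + 2 * D * Q)%N by rewrite -mulnDr subnK.
rewrite mulnDr -addnA leq_add2l -!mulnA [leqRHS]mul2n -addnn.
by apply: leq_add RD; rewrite mulnCA leq_mul2l xQ orbT.
Qed.

Section CstarFacts.
Variables (p : nat) (p_pr : prime p) (n : nat) (r : 'I_n -> nat).
Local Notation Qp := (padic p_pr).

Definition Cw_entry (i : nat) : Qp :=
  p%:R ^+ pad r i / p%:R ^+ pad r i.+1 * (-1) ^+ (n - i).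

Lemma Cstar_w_long :
  Cstar p_pr r *m intmx Qp (w_long n) = antidiag (fun i : 'I_n.+1 => Cw_entry i).
Proof.
apply/matrixP => i j; rewrite w_longE mul_diag_mx !mxE; case: ifP; last by rewrite mulr0.
by move=> _; congr (_ * _); rewrite expfzDr ?p_neq0 // -exprnN -exprnP.
Qed.

Lemma Cw_entry_neq0 i : Cw_entry i != 0.
Proof. by rewrite !mulf_neq0 ?invr_eq0 ?pX_neq0 // (punit_neq0 (punit_sign p_pr _)). Qed.

Lemma pad0 : pad r 0 = 0%N.
Proof. by rewrite /pad big_pred0. Qed.

Lemma pad_max : pad r n.+1 = 0%N.
Proof. by rewrite /pad big_pred0 // => i; rewrite eqSS; have := ltn_ord i; case: ltngtP. Qed.

Lemma pad_ord (i : 'I_n) : pad r i.+1 = r i.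
Proof. by rewrite /pad (big_pred1 i) // => j; rewrite eqSS. Qed.

Lemma sum_pad : (\sum_(i < n.+1) pad r i.+1 = \sum_(i < n) r i)%N.
Proof. by rewrite big_ord_recr /= pad_max addn0; apply: eq_bigr => i _; rewrite pad_ord. Qed.

(** The product telescopes to a sign times p^(-r), with r the next exponent; this matches the
    normalization of [iwa]. *)
Lemma prod_Cw_entry (i : 'I_n.+1) :
  (\prod_(j < n.+1 | (j <= i)%N) Cw_entry j) * p%:R ^+ pad r i.+1 \in punit.
Proof.
rewrite (big_ord_narrow (F := fun j : 'I_n.+1 => Cw_entry j) (ltn_ord i)) /=.
elim: (i.+1) => [|k IH]; first by rewrite big_ord0 mul1r pad0 expr0 punit1.
rewrite big_ord_recr /= {2}/Cw_entry mulf_telescope ?pX_neq0 //.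
exact: punitM IH (punit_sign p_pr _).
Qed.

End CstarFacts.

(** * The theorem *)

Theorem corollary1 (R : realType) (n : nat) (n_ge2 : (2 <= n)%N) :
  exists delta K : R, 0 < delta /\ 0 < K /\
  forall (p : nat) (p_pr : prime p) (r : 'I_n -> nat) (psi psi' : 'I_n -> int),
    ((ComplexField.Normc.normc
        (@Kl R p p_pr n psi psi' (Cstar p_pr r) (w_long n)))%:E
     <= K%:E * (\big[maxe/-oo]_(j < n) inv_sqrt (padic_abs R p (psi j)))
        * (((\prod_(k < n) (p%:R ^+ r k)) `^ (1 - delta))%R)%:E)%E.
Proof.
have n0 : (0 < n)%N by apply: ltnW.
have D0 := saving_den_gt0 n.
have [delta delta0 [K K0 KP]] := power_saving R (log_exponent n) n0 D0.
exists delta; exists K; do 2![split => //] => p p_pr r psi psi'.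
have p1 := prime_gt1 p_pr; have p0 : (0 : R) < p%:R by rewrite ltr0n prime_gt0.
set mx := \big[maxe/-oo%E]_(j < n) _.
have mxP j : (inv_sqrt (padic_abs R p (psi j)) <= mx)%E by exact: le_bigmax.
set Pr := \prod_(k < n) _.
have Pr0 : 0 < Pr `^ (1 - delta) by rewrite powR_gt0 // prodr_gt0 // => k _; rewrite exprn_gt0.
case: (pselect (exists j, psi j = 0)) => [[j psi0]|/forallNP psiN].
  have mxy : mx = +oo%E.
    apply/eqP; rewrite -leye_eq; have := mxP j.
    by rewrite /inv_sqrt /padic_abs psi0 !eqxx.
  by rewrite mxy gt0_muley ?lte_fin // gt0_mulye ?lte_fin // leey.
have psi_neq0 j : psi j != 0 by apply/eqP; exact: psiN.
(* The largest valuation among the psi_j gives the largest factor |psi_j|_p^(-1/2); [M] is that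
   factor. *)
pose v j := logn p `|psi j|.
pose j0 : 'I_n := [arg max_(j > Ordinal n0) v j].
have vmax j : (v j <= v j0)%N by rewrite /j0; case: arg_maxnP => // i _; apply.
pose M := (Num.sqrt (p%:R ^- v j0) : R)^-1.
have M2 : M ^+ 2 = p%:R ^+ v j0.
  by rewrite exprVn sqr_sqrtr ?invrK // invr_ge0 exprn_ge0 // ltW.
have Mpos : 0 < M by rewrite invr_gt0 sqrtr_gt0 invr_gt0 exprn_gt0.
have M1 : 1 <= M.
  rewrite -(ler_pXn2r (isT : (0 < 2)%N)) ?nnegrE ?(ltW Mpos) //.
  by rewrite expr1n M2 exprn_ege1 // ler1n ltnW.
have Mmx : (M%:E <= mx)%E.
  apply: le_trans (mxP j0); rewrite /inv_sqrt /padic_abs (negPf (psi_neq0 j0)).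
  by rewrite gt_eqF // invr_gt0 exprn_gt0.
apply: (@le_trans _ _ (K%:E * M%:E * (Pr `^ (1 - delta))%:E)%E); last first.
  apply: lee_wpmul2r; first by rewrite lee_fin ltW.
  by apply: lee_wpmul2l => //; rewrite lee_fin ltW.
rewrite -!EFinM lee_fin.
set R0 := (\sum_(i < n) r i)%N.
have PrE : Pr = p%:R ^+ R0 by rewrite /Pr /R0 GRing.expr_sum.
(* [Q] is the ceiling of R0/D, the largest saving the count allows. With t = floor(Q/(2n)) the loss
   p^(n t) uses at most half of it. *)
pose D := saving_den n; pose Q := ((R0 + D.-1) %/ D)%N; pose t := (Q %/ (2 * n))%N.
have DQ : (D * Q < R0 + D)%N.
  rewrite mulnC; apply: leq_ltn_trans (leq_trunc_div _ _) _.
  by rewrite ltn_add2l prednK.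
have QD : (R0 <= D * Q)%N.
  have := ltn_ceil (R0 + D.-1) D0; rewrite -/D -/Q mulSn => h; rewrite mulnC; lia.
have QR : (Q <= R0)%N.
  rewrite leqNgt; apply/negP => lt; move: DQ; apply/negP; rewrite -leqNgt.
  apply: leq_trans (leq_mul (leqnn D) lt); rewrite mulnS addnC leq_add2l.
  by rewrite leq_pmull.
have tQ : (2 * (n * t) <= Q)%N by rewrite mulnA mulnC leq_trunc_div.
have Qt : (Q < t.+1 * (2 * n))%N by rewrite ltn_ceil // muln_gt0.
pose B := 4 * M * expR (- (t.+1%:R * ln p%:R) / 12) : R.
have B0 : 0 <= B by rewrite !mulr_ge0 ?expR_ge0 // ltW.
have BP j m : (t < m + logn p `|psi j|)%N -> 4 ^+ 12 <= B ^+ 12 * p%:R ^+ m.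
  move=> tm; rewrite /B [_ ^+ 12 in leRHS]exprMn [_ ^+ 12 in leRHS]exprMn -expRM_natr divfK //.
  rewrite expRN -(natrX_expR R t.+1 (prime_gt0 p_pr)) natrX.
  have ler_peM3 (c a b x : R) : 0 <= c -> 1 <= a * (b * x) -> c <= c * a * b * x.
    by move=> c0 h; rewrite -!mulrA ler_peMr.
  apply: ler_peM3; first exact: exprn_ge0.
  (* It remains to see that t + 1 <= 6 v(j0) + m, which follows from t < m + v(j) and v(j) <=
     v(j0). *)
  have -> : M ^+ 12 = p%:R ^+ (v j0 * 6) by rewrite (exprM M 2 6) M2 exprM.
  rewrite mulrCA -exprD ler_pdivlMl ?exprn_gt0 // mulr1 ler_eXn2l ?ltr1n //.
  by apply: leq_trans tm _; have := vmax j; rewrite /v; lia.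
have := Kl_sum_bound (s := fun i : 'I_n.+1 => Cw_entry p_pr r i)
  (fun i => Cw_entry_neq0 p_pr r i) psi' (r := fun i => pad r i.+1) (pad_max r)
  (prod_Cw_entry p_pr r) psi_neq0 B0 BP.
rewrite sum_pad -/R0 => /(_ Q DQ); rewrite /Kl Cstar_w_long => h.
apply: le_trans h _; rewrite PrE; apply: KP => //.
  exact: saving_exponent QR QD tQ.
rewrite mulnA mulnC; apply: leq_trans QD _; rewrite leq_mul2l.
by rewrite (ltnW Qt) orbT.
Qed.
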